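(* Given $K>0$, there exists a constant $C_K>0$ such that for any compact subset $\Omega$ of $\mathbb{R}^d$, any probability measure $\mu$ on $\Omega$, any integers $1\le v\le N$, any dictionary $\Phi_N=\{\varphi_j\}_{j=1}^N\subset\mathcal{C}(\Omega)$ satisfying $\sup_{x\in\Omega}|\varphi_j(x)|\le1$ ($1\le j\le N$) and $\sum_{j=1}^N|a_j|^2\le K\|\sum_{j=1}^Na_j\varphi_j\|_{L_2(\Omega,\mu)}^2$ for all $(a_j)\in\mathbb{C}^N$, and any $W$ which is the unit ball of a Banach space $V\subset\mathcal{C}(\Omega)$, we have $$\kappa_m(W)\le5\,\sigma_v(W,\Phi_N)_\infty$$ provided $m\ge C_K\,v(\log N)(\log(2v))^2(\log(2v)+\log\log N)$.
   Context: $I_\mu(f)=\int_\Omega fd\mu$; $\kappa_m(\mathbf{F}):=\inf_{\xi^1,\dots,\xi^m\in\Omega;\ \lambda_1,\dots,\lambda_m}\sup_{f\in\mathbf{F}}|I_\mu(f)-\sum_{\nu=1}^m\lambda_\nu f(\xi^\nu)|$. $\Sigma_v(\Phi_N)$ is the union of all spaces $\operatorname{span}\{\varphi_j:j\in J\}$, $J\subset\{1,\dots,N\}$, $|J|=v$, and $\sigma_v(\mathbf{F},\Phi_N)_\infty=\sup_{f\in\mathbf{F}}\inf_{g\in\Sigma_v(\Phi_N)}\max_{x\in\Omega}|f(x)-g(x)|$. *)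

(* Defs.v *)
From HB Require Import structures.
From mathcomp Require Import all_boot all_order all_algebra.
From mathcomp Require Import all_classical all_reals all_analysis.
From mathcomp Require Import complex.
Set Implicit Arguments. Unset Strict Implicit. Unset Printing Implicit Defensive.
Import Order.TTheory GRing.Theory Num.Theory.
Import numFieldNormedType.Exports.
Local Open Scope classical_set_scope.
Local Open Scope ring_scope.

Definition borelRd (R : realType) (d : nat) :=
  g_sigma_algebraType (@open 'rV[R]_d).

Definition cabs (R : realType) (z : R[i]) : R := mathcomp.real_closed.complex.ComplexField.Normc.normc z.

Definition ccontinuous_on (R : realType) (d : nat) (Omega : set 'rV[R]_d)
    (f : 'rV[R]_d -> R[i]) : Prop :=
  forall x, Omega x -> forall e : R, 0 < e ->
    exists2 delta : R, 0 < delta &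
      forall y, Omega y -> `|x - y| < delta -> cabs (f x - f y) < e.

Definition cintegral (R : realType) (d : nat)
    (mu : {measure set (borelRd R d) -> \bar R}) (Omega : set 'rV[R]_d)
    (f : 'rV[R]_d -> R[i]) : R[i] :=
  ((Rintegral mu Omega (fun x => @mathcomp.real_closed.complex.Re R (f x)))
   +i* (Rintegral mu Omega (fun x => @mathcomp.real_closed.complex.Im R (f x))))%C.

Definition L2norm2 (R : realType) (d : nat)
    (mu : {measure set (borelRd R d) -> \bar R}) (Omega : set 'rV[R]_d)
    (g : 'rV[R]_d -> R[i]) : \bar R :=
  (\int[mu]_(x in Omega) ((cabs (g x)) ^+ 2)%:E)%E.

(* V is a (complex) Banach space contained in C(Omega), with norm nrm.
   Elements of C(Omega) are functions on Omega, so identities between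
   functions are understood on Omega. *)
Definition banach_subspace_of_C (R : realType) (d : nat) (Omega : set 'rV[R]_d)
    (V : set ('rV[R]_d -> R[i])) (nrm : ('rV[R]_d -> R[i]) -> R) : Prop :=
  (forall f, V f -> ccontinuous_on Omega f) /\
      V (fun _ => 0) /\
      (forall (a : R[i]) f g, V f -> V g -> V (fun x => a * f x + g x)) /\
      (forall f g, V f -> V g -> (forall x, Omega x -> f x = g x) -> nrm f = nrm g) /\
      (forall f, V f -> 0 <= nrm f) /\
      (forall f, V f -> nrm f = 0 -> forall x, Omega x -> f x = 0) /\
      (forall (a : R[i]) f, V f -> nrm (fun x => a * f x) = cabs a * nrm f) /\
      (forall f g, V f -> V g -> nrm (fun x => f x + g x) <= nrm f + nrm g) /\
      (forall u : nat -> 'rV[R]_d -> R[i], (forall n, V (u n)) ->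
         (forall e : R, 0 < e -> exists M : nat, forall n k, (M <= n)%N -> (M <= k)%N ->
             nrm (fun x => u n x - u k x) < e) ->
         exists2 f, V f &
           forall e : R, 0 < e -> exists M : nat, forall n, (M <= n)%N ->
             nrm (fun x => u n x - f x) < e).

Definition unit_ball (R : realType) (d : nat) (V : set ('rV[R]_d -> R[i]))
    (nrm : ('rV[R]_d -> R[i]) -> R) : set ('rV[R]_d -> R[i]) :=
  [set f | V f /\ nrm f <= 1].

Definition kappa (R : realType) (d : nat)
    (mu : {measure set (borelRd R d) -> \bar R}) (Omega : set 'rV[R]_d)
    (m : nat) (F : set ('rV[R]_d -> R[i])) : \bar R :=
  ereal_inf [set e | exists (xi : 'I_m -> 'rV[R]_d) (lam : 'I_m -> R[i]),
    (forall nu, Omega (xi nu)) /\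
    e = ereal_sup [set (cabs (cintegral mu Omega f
                         - \sum_(nu < m) lam nu * f (xi nu)))%:E | f in F]].

Definition Sigma_v (R : realType) (d N : nat) (v : nat)
    (Phi : 'I_N -> 'rV[R]_d -> R[i]) : set ('rV[R]_d -> R[i]) :=
  [set g | exists (J : {set 'I_N}) (c : 'I_N -> R[i]),
     #|J| = v /\ g = (fun x => \sum_(j in J) c j * Phi j x)].

Definition sup_dist (R : realType) (d : nat) (Omega : set 'rV[R]_d)
    (f g : 'rV[R]_d -> R[i]) : \bar R :=
  ereal_sup [set (cabs (f x - g x))%:E | x in Omega].

Definition sigma_inf (R : realType) (d N : nat) (Omega : set 'rV[R]_d)
    (v : nat) (F : set ('rV[R]_d -> R[i])) (Phi : 'I_N -> 'rV[R]_d -> R[i])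
    : \bar R :=
  ereal_sup [set ereal_inf [set sup_dist Omega f g | g in Sigma_v v Phi]
            | f in F].

(* Main.v *)
Require Import Defs.
From HB Require Import structures.
From mathcomp Require Import all_boot all_order all_algebra.
From mathcomp Require Import all_classical all_reals all_analysis.
From mathcomp Require Import complex ring lra.
Set Implicit Arguments. Unset Strict Implicit. Unset Printing Implicit Defensive.
Import Order.TTheory GRing.Theory Num.Theory.
Import numFieldNormedType.Exports.
Local Open Scope classical_set_scope.
Local Open Scope ring_scope.

(** By Bakhvalov's argument (one-step Hahn-Banach, once per node), the error of
the best quadrature with nodes xi is the supremum of |I(f)| over the f in W
vanishing at xi.  If f vanishes at xi and g in Sigma_v satisfies
|f - g| <= s, then |g| <= s at the nodes, so it suffices to find nodes with
|I(g)| <= 4 max_nu |g(xi_nu)| for all g in Sigma_v, and even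
||g||_2^2 <= 15 max_nu |g(xi_nu)|^2 after replacing mu by a finite weighted set.

Normalize ||g||_2 = 1.  The l1 norm of the coefficients of g is at most a
multiple B of sqrt v, hence |g| <= B, and one of the T = O(log B) level sets
{|g| >= tau}, tau = 2^t / 2, has mass at least of order 1 / (tau^2 T).  Maurey's
empirical method with L of order (B / tau)^2 log m dictionary terms yields h with
|g - h| <= tau / 8 at all the nodes and on half of that level set.  There are only
(2N)^L candidates h, so about tau^2 T L log N = O(v T log N log m) points hit all
the large sets {|h| >= 7 tau / 8} at once, for all levels; at a hit, |g| >= 3 / 8. *)

(** * Hitting sets and Maurey's method *)

(** Inverting e^(-y) >= 1 - y gives e^y <= 1 / (1 - y), and (1 - y)(1 + y + 2y^2) = 1 + y^2 (1 - 2y)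
    >= 1. *)
Lemma expR_le_quad (R : realType) (y : R) : y <= 1 / 2 ->
  expR y <= 1 + y + 2 * y ^+ 2.
Proof.
move=> y2; have h : 1 - y <= expR (- y) by exact: expR_ge1Dx.
have y1 : 0 < 1 - y by lra.
rewrite -[expR y]invrK -expRN.
apply: (@le_trans _ _ (1 - y)^-1); first by rewrite lef_pV2 // posrE ?expR_gt0.
rewrite -[leLHS]mul1r ler_pdivrMr //.
have : 0 <= y ^+ 2 * (1 - 2 * y) by apply: mulr_ge0; [exact: sqr_ge0|lra].
nra.
Qed.

(** Derandomizes each probabilistic choice: a minimizer of [f] does at least as well as an index
    drawn with law [q]. *)
Lemma exists_le_average (R : realType) (I : finType) (q f : I -> R) :
  (forall i, 0 <= q i) -> \sum_i q i = 1 -> exists i, f i <= \sum_i q i * f i.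
Proof.
move=> q0 q1.
have [i0 _|I0] := pickP (fun _ : I => true); last first.
  by move: q1; rewrite big_pred0 // => /esym/eqP; rewrite oner_eq0.
have [i _ hi] := @Order.TotalTheory.arg_minP _ R I i0 predT f isT.
exists i; rewrite -[f i]mul1r -q1 mulr_suml; apply: ler_sum => j _.
by rewrite ler_wpM2l // hi.
Qed.

(** A Bernstein-type moment bound: centring kills the linear term of the quadratic bound on e^y, and
    1 + 2v <= e^(2v). *)
Lemma average_expR_le (R : realType) (I : finType) (q y : I -> R) (v : R) :
  (forall i, 0 <= q i) -> \sum_i q i = 1 -> \sum_i q i * y i = 0 ->
  (forall i, y i <= 1 / 2) -> \sum_i q i * y i ^+ 2 <= v ->
  \sum_i q i * expR (y i) <= expR (2 * v).
Proof.
move=> q0 q1 qy y2 qv.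
apply: (@le_trans _ _ (1 + 2 * v)); last exact: expR_ge1Dx.
apply: (@le_trans _ _ (\sum_i (q i + q i * y i + 2 * (q i * y i ^+ 2)))).
  apply: ler_sum => i _.
  have := ler_wpM2l (q0 i) (expR_le_quad (y2 i)); lra.
rewrite !big_split /= q1 qy -mulr_sumr addr0.
lra.
Qed.

(* The method of conditional expectations: a uniformly random next point
   keeps the expected number of sets that will never be hit below one. *)
Lemma exists_hitting_tuple (R : realType) (P I : finType) (w : P -> R)
    (E : I -> pred P) (p c : I -> R) (m : nat) :
  (forall x, 0 <= w x) -> \sum_x w x = 1 ->
  (forall i, 0 <= c i) -> (forall i, p i <= 1) ->
  (forall i, c i * p i <= c i * \sum_(x | E i x) w x) ->
  \sum_i c i * (1 - p i) ^+ m < 1 ->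
  exists s : m.-tuple P, \sum_(i | ~~ has (E i) s) c i < 1.
Proof.
move=> w0 w1; elim: m c => [|m IH] c c0 p1 cp hs.
  exists [tuple]; apply: le_lt_trans hs.
  by apply: ler_sum => i _; rewrite expr0 mulr1.
(* Choosing [x] as the next point discards the sets that contain it by zeroing their weights. On
   average this multiplies the weight of set [i] by one minus its mass, hence by at most
   [1 - p i]. *)
pose c' x i := if E i x then 0 else c i.
have [x hx] := exists_le_average (fun x => \sum_i c' x i * (1 - p i) ^+ m) w0 w1.
have c'0 i : 0 <= c' x i by rewrite /c'; case: ifP.
have [||s hs'] := IH (c' x) c'0 p1.
- by move=> i; rewrite /c'; case: ifP => // _; rewrite !mul0r.
- apply: le_lt_trans hs; apply: (le_trans hx).
  under eq_bigr do rewrite mulr_sumr.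
  rewrite exchange_big /=; apply: ler_sum => i _.
  have -> : \sum_y w y * (c' y i * (1 - p i) ^+ m) =
      (c i * (1 - \sum_(y | E i y) w y)) * (1 - p i) ^+ m.
    have -> : 1 - \sum_(y | E i y) w y = \sum_(y | ~~ E i y) w y.
      by rewrite -w1 [X in X - _](bigID (E i)) /= addrAC subrr add0r.
    rewrite (bigID (E i)) /= big1 => [|y Ey]; last by rewrite /c' Ey mul0r mulr0.
    rewrite add0r mulr_sumr mulr_suml; apply: eq_bigr => y /negbTE Ey.
    by rewrite /c' Ey; ring.
  rewrite exprS mulrA ler_wpM2r ?exprn_ge0 ?subr_ge0 //.
  have := cp i; lra.
exists [tuple of x :: s]; apply: le_lt_trans hs'.
rewrite [leLHS]big_mkcond [leRHS]big_mkcond /=; apply: ler_sum => i _.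
by rewrite /c'; case: (E i x); case: (has _ _).
Qed.

Section Maurey.
Variables (R : realType) (P J : finType) (psi : J -> P -> R) (B : R).

Definition signed_atom (u : J * bool) (x : P) : R :=
  (if u.2 then B else - B) * psi u.1 x.

Hypothesis psi1 : forall j x, `|psi j x| <= 1.
Hypothesis B0 : 0 < B.

(** The share |a_j| / B goes to the atom carrying the sign of a_j. The remaining mass is spread
    evenly over all atoms, where opposite signs cancel. *)
Lemma convex_signed_atoms (a : J -> R) (j0 : J) : \sum_j `|a j| <= B ->
  exists q : J * bool -> R, [/\ forall u, 0 <= q u, \sum_u q u = 1 &
    forall x, \sum_u q u * signed_atom u x = \sum_j a j * psi j x].
Proof.
move=> aB.
pose r := (1 - (\sum_j `|a j|) / B) / (2 * #|J|%:R).
have J0 : 0 < #|J|%:R :> R by rewrite ltr0n; apply/card_gt0P; exists j0.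
have r0 : 0 <= r.
  rewrite divr_ge0 ?mulr_ge0 ?ler0n // subr_ge0 ler_pdivrMr //; lra.
have Bu : B != 0 by rewrite gt_eqF.
exists (fun u => (`|a u.1| + (if u.2 then a u.1 else - a u.1)) / (2 * B) + r).
split.
- case=> j b /=; rewrite addr_ge0 //; apply: divr_ge0; last by rewrite mulr_ge0 ?ltW.
  have := ler_norm (a j); have := ler_norm (- a j); rewrite normrN.
  by case: b; lra.
- rewrite -(pair_bigA _ (fun j (b : bool) =>
    (`|a j| + (if b then a j else - a j)) / (2 * B) + r)) /=.
  under eq_bigr do rewrite big_bool /=.
  rewrite (eq_bigr (fun j => `|a j| / B + 2 * r)); last by move=> j _; field.
  rewrite big_split /= -mulr_suml sumr_const -mulr_natr /r; field.
  by rewrite Bu gt_eqF.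
- move=> x; rewrite -(pair_bigA _ (fun j (b : bool) =>
    ((`|a j| + (if b then a j else - a j)) / (2 * B) + r) *
    signed_atom (j, b) x)) /=.
  apply: eq_bigr => j _; rewrite big_bool /signed_atom /=; field.
  exact: Bu.
Qed.

Lemma signed_atom_sqr_le u x : signed_atom u x ^+ 2 <= B ^+ 2.
Proof.
rewrite /signed_atom exprMn -[leRHS]mulr1.
have -> : (if u.2 then B else - B) ^+ 2 = B ^+ 2 by case: ifP; rewrite ?sqrrN.
rewrite ler_wpM2l ?sqr_ge0 // -[leLHS]real_normK ?num_real //.
by rewrite expr_le1.
Qed.

Lemma normr_signed_atom_le u x : `|signed_atom u x| <= B.
Proof.
rewrite /signed_atom normrM -[leRHS]mulr1 ler_pM //.
by case: ifP; rewrite ?normrN gtr0_norm.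
Qed.

(* Maurey's empirical method, derandomized: the terms of the average are
   chosen one at a time so as to keep an exponential potential small. *)
Lemma maurey_potential (a : J -> R) (j0 : J) (rho : P -> R) (s : R) (L : nat) :
  \sum_j `|a j| <= B -> (forall x, 0 <= rho x) -> 0 <= s -> s * (4 * B) <= 1 ->
  let G x := \sum_j a j * psi j x in
  exists z : L.-tuple (J * bool),
    let D x := \sum_(u <- z) signed_atom u x - L%:R * G x in
    \sum_x rho x * (expR (s * D x) + expR (- (s * D x))) <=
    (2 * \sum_x rho x) * expR (2 * (s * B) ^+ 2) ^+ L.
Proof.
move=> aB rho0 s0 sB G.
have [q [q0 q1 qG]] := convex_signed_atoms j0 aB.
have {}qG x : \sum_u q u * signed_atom u x = G x by exact: qG.
have GB x : `|G x| <= B.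
  rewrite -qG; apply: (le_trans (ler_norm_sum _ _ _)).
  rewrite -[leRHS]mul1r -q1 mulr_suml; apply: ler_sum => u _.
  by rewrite normrM ger0_norm // ler_wpM2l // normr_signed_atom_le.
(* For either sign e = s or e = -s, the increment is centred, at most s * 2B <= 1/2 in size, and of
   variance at most (sB)^2. *)
have key (e : R) x : `|e| = s ->
    \sum_u q u * expR (e * (signed_atom u x - G x)) <= expR (2 * (s * B) ^+ 2).
  move=> es; have e2 : e ^+ 2 = s ^+ 2 by rewrite -es real_normK ?num_real.
  apply: average_expR_le => //.
  - under eq_bigr do rewrite mulrBr mulrBr.
    rewrite sumrB (eq_bigr (fun u => e * (q u * signed_atom u x))); last first.
      by move=> u _; ring.
    by rewrite -mulr_sumr qG -mulr_suml q1; ring.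
  - move=> u; apply: (le_trans (ler_norm _)); rewrite normrM es.
    have : `|signed_atom u x - G x| <= 2 * B.
      apply: (le_trans (ler_normB _ _)).
      have := normr_signed_atom_le u x; have := GB x; lra.
    move=> h; apply: (@le_trans _ _ (s * (2 * B))); first by rewrite ler_wpM2l.
    lra.
  - rewrite (eq_bigr (fun u => s ^+ 2 * (q u * signed_atom u x ^+ 2) +
      (- (2 * s ^+ 2 * G x) * (q u * signed_atom u x) + s ^+ 2 * G x ^+ 2 * q u)));
      last by move=> u _; rewrite exprMn e2; ring.
    rewrite !big_split /= -!mulr_sumr qG q1 exprMn.
    have : \sum_u q u * signed_atom u x ^+ 2 <= B ^+ 2.
      rewrite -[leRHS]mul1r -q1 mulr_suml; apply: ler_sum => u _.
      by rewrite ler_wpM2l // signed_atom_sqr_le.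
    move=> h; have := ler_wpM2l (sqr_ge0 s) h.
    have : 0 <= s ^+ 2 * G x ^+ 2 by rewrite mulr_ge0 ?sqr_ge0.
    set Q := \sum_u _; lra.
elim: L => [|L [z hz]].
  exists [tuple] => /=; rewrite expr0 mulr1 mulr_sumr; apply: ler_sum => x _.
  by rewrite big_nil mul0r subrr mulr0 oppr0 expR0; lra.
pose D x := \sum_(u <- z) signed_atom u x - L%:R * G x.
have {}hz : \sum_x rho x * (expR (s * D x) + expR (- (s * D x))) <=
  (2 * \sum_x rho x) * expR (2 * (s * B) ^+ 2) ^+ L by exact: hz.
pose F u := \sum_x rho x * (expR (s * (D x + (signed_atom u x - G x))) +
  expR (- (s * (D x + (signed_atom u x - G x))))).
have [u hu] := exists_le_average F q0 q1.
exists [tuple of u :: z] => /=.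
rewrite (_ : \sum_x _ = F u); last first.
  rewrite /F; apply: eq_bigr => x _.
  suff -> : \sum_(u0 <- u :: z) signed_atom u0 x - L.+1%:R * G x =
     D x + (signed_atom u x - G x) by [].
  by rewrite big_cons /D -natr1; ring.
apply: (le_trans hu).
rewrite exprSr mulrA; apply: (@le_trans _ _
   ((\sum_x rho x * (expR (s * D x) + expR (- (s * D x)))) *
    expR (2 * (s * B) ^+ 2))); last by rewrite ler_wpM2r ?expR_ge0.
rewrite mulr_suml /F; under eq_bigr do rewrite mulr_sumr.
rewrite exchange_big /=; apply: ler_sum => x _.
rewrite (eq_bigr (fun u => (rho x * expR (s * D x)) *
    (q u * expR (s * (signed_atom u x - G x))) +
    (rho x * expR (- (s * D x))) *
    (q u * expR (- s * (signed_atom u x - G x))))); last first.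
  move=> v _; set y := signed_atom v x - G x.
  by rewrite mulNr (mulrDr s) opprD !expRD; ring.
rewrite big_split /= -!mulr_sumr.
rewrite [leRHS](_ : _ = rho x * expR (s * D x) * expR (2 * (s * B) ^+ 2) +
  rho x * expR (- (s * D x)) * expR (2 * (s * B) ^+ 2)); last by ring.
rewrite lerD //.
  by rewrite ler_wpM2l ?mulr_ge0 ?expR_ge0 // key // ger0_norm.
by rewrite ler_wpM2l ?mulr_ge0 ?expR_ge0 // key // normrN ger0_norm.
Qed.

End Maurey.

(** * Sampling on a finite weighted set *)

(** If every dyadic level set were lighter than claimed, summing 4 tau^2 over the levels below |G|
    would give a mean square of less than 1/4 + 3/4. *)
Lemma exists_heavy_level (R : realType) (P : finType) (w G : P -> R) (B : R) (T : nat) :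
  (forall x, 0 <= w x) -> \sum_x w x = 1 -> \sum_x w x * G x ^+ 2 = 1 ->
  (forall x, `|G x| <= B) -> 2 * B < 2 ^+ T -> (0 < T)%N ->
  exists t : 'I_T, let tau := 2 ^+ t / 2 in
    3 / (16 * tau ^+ 2 * T%:R) <= \sum_(x | tau <= `|G x|) w x.
Proof.
move=> w0 w1 wG GB BT T0; apply: contrapT => hN.
have TR : 0 < T%:R :> R by rewrite ltr0n.
pose tau (t : nat) : R := 2 ^+ t / 2.
have h (t : 'I_T) : \sum_(x | tau t <= `|G x|) w x < 3 / (16 * tau t ^+ 2 * T%:R).
  by rewrite ltNge; apply/negP => ht; apply: hN; exists t.
have tau0 t : 0 < tau t by rewrite /tau divr_gt0 ?exprn_gt0.
have pw x : G x ^+ 2 <= 1 / 4 + \sum_(t < T | tau t <= `|G x|) 4 * tau t ^+ 2.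
  have s0 : 0 <= \sum_(t < T | tau t <= `|G x|) 4 * tau t ^+ 2.
    by apply: sumr_ge0 => t _; rewrite mulr_ge0 ?sqr_ge0.
  have gE : G x ^+ 2 = `|G x| ^+ 2 by rewrite real_normK ?num_real.
  have g0 := normr_ge0 (G x).
  have [g12|g12] := ltP (`|G x|) (1 / 2); first by rewrite gE; nra.
  (* Level [T] lies above [B], so the first level [t.+1] above |G x| has [t < T], and tau_t <= |G x|
     < 2 tau_t. *)
  have ex : exists t, `|G x| < tau t by exists T; rewrite /tau; have := GB x; lra.
  have [[|t] ht tmin] := ex_minnP ex; first by move: ht; rewrite /tau expr0; lra.
  have tT : (t < T)%N by apply: tmin; rewrite /tau; have := GB x; lra.
  have hle : tau t <= `|G x|.
    rewrite leNgt; apply/negP => hlt; have := tmin t; rewrite ltnn => /(_ _)/negP.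
    by apply.
  rewrite (bigD1 (Ordinal tT)) //=.
  have : 0 <= \sum_(i < T | (tau i <= `|G x|) && (i != Ordinal tT)) 4 * tau i ^+ 2.
    by apply: sumr_ge0 => i _; rewrite mulr_ge0 ?sqr_ge0.
  have e : tau t.+1 = 2 * tau t by rewrite /tau exprS; lra.
  have := tau0 t; move: ht; rewrite e gE; nra.
have : \sum_x w x * G x ^+ 2 < 1.
  apply: (@le_lt_trans _ _ (\sum_x (w x * (1 / 4) +
     \sum_(t < T) 4 * tau t ^+ 2 * (if tau t <= `|G x| then w x else 0)))).
    apply: ler_sum => x _; apply: (le_trans (ler_wpM2l (w0 x) (pw x))).
    rewrite mulrDr lerD2l mulr_sumr big_mkcond; apply: ler_sum => t _.
    by case: ifP => _; rewrite ?mulr0 // mulrC.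
  rewrite big_split /= -mulr_suml w1 exchange_big /=.
  suff : \sum_(j < T) \sum_(i : P) 4 * tau j ^+ 2 *
      (if tau j <= `|G i| then w i else 0) < \sum_(j < T) 3 / (4 * T%:R).
    have -> : \sum_(j < T) 3 / (4 * T%:R) = 3 / 4 :> R; last lra.
    by rewrite sumr_const card_ord -[LHS]mulr_natr; field; rewrite gt_eqF.
  apply: ltr_sum; first by apply/hasP; exists (Ordinal T0); rewrite ?mem_index_enum.
  move=> t _; rewrite -mulr_sumr -big_mkcond /=; move: (h t).
  have t4 : 0 < 4 * tau t ^+ 2 by rewrite mulr_gt0 ?exprn_gt0.
  move=> ht; apply: (@lt_le_trans _ _ (4 * tau t ^+ 2 * (3 / (16 * tau t ^+ 2 * T%:R)))).
    by rewrite ltr_pM2l.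
  rewrite le_eqVlt (_ : _ == _) //; apply/eqP; field; rewrite !gt_eqF //.
by rewrite wG ltxx.
Qed.

Lemma sum_count_mem_size (P : finType) (s : seq P) :
  (\sum_x count_mem x s = size s)%N.
Proof.
elim: s => [|y s IH] /=; first by rewrite big1.
rewrite big_split /= IH (bigD1 y) //= eqxx big1 // => x /negbTE xy.
by rewrite eq_sym xy.
Qed.

(** One potential serves both conclusions: [rho] puts mass at least 1 on each node and total mass 2
    on [A]. If the points with a large error have [rho]-mass below 1, no node is among them, and
    they carry less than half of the mass of [A]. *)
Lemma exists_maurey_average (R : realType) (P J : finType) (psi : J -> P -> R)
    (B : R) (a : J -> R) (j0 : J) (w : P -> R) (A : pred P) (tau : R) (L m : nat)
    (xi : m.-tuple P) :
  (forall j x, `|psi j x| <= 1) -> 0 < B -> \sum_j `|a j| <= B ->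
  (forall x, 0 <= w x) -> 0 < \sum_(x | A x) w x ->
  0 < tau -> tau <= 8 * B -> (0 < L)%N ->
  2 * (m%:R + 2) < expR (L%:R * tau ^+ 2 / (512 * B ^+ 2)) ->
  exists z : L.-tuple (J * bool),
    let D x := (\sum_(u <- z) signed_atom psi B u x) / L%:R - \sum_j a j * psi j x in
    (forall x, x \in xi -> `|D x| <= tau / 8) /\
    (\sum_(x | A x) w x) / 2 <= \sum_(x | A x && (`|D x| <= tau / 8)) w x.
Proof.
move=> psi1 B0 aB w0 wA tau0 tauB L0 hL.
have LR : 0 < L%:R :> R by rewrite ltr0n.
(* This [s] maximizes the exponent s tau / 8 - 2 (sB)^2 gained per term; the maximum is tau^2 / (512
   B^2). *)
pose s := tau / (32 * B ^+ 2).
have B2 : 0 < B ^+ 2 by rewrite exprn_gt0.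
have s0 : 0 < s by rewrite /s divr_gt0 // mulr_gt0.
have sB : s * (4 * B) <= 1.
  rewrite /s (_ : _ * _ = tau / (8 * B)); last by field; rewrite gt_eqF.
  rewrite ler_pdivrMr; [lra|by rewrite mulr_gt0].
set W := \sum_(x | A x) w x in wA *.
pose rho x := (count_mem x xi)%:R + 2 / W * (if A x then w x else 0).
have rho0 x : 0 <= rho x.
  rewrite addr_ge0 // mulr_ge0 ?divr_ge0 //; first exact: ltW.
  by case: ifP.
have rhoS : \sum_x rho x = m%:R + 2.
  rewrite big_split /= -natr_sum -mulr_sumr -big_mkcond /= -/W; congr (_ + _).
    by rewrite sum_count_mem_size size_tuple.
  by field; rewrite gt_eqF.
have [z hz] := maurey_potential psi1 B0 j0 L aB rho0 (ltW s0) sB.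
exists z => D.
pose G x := \sum_j a j * psi j x.
pose S x := \sum_(u <- z) signed_atom psi B u x.
have DE x : S x - L%:R * G x = L%:R * D x.
  by rewrite /D -/(S x) -/(G x); field; rewrite gt_eqF.
(* Markov's inequality: at a bad point one of the two exponentials of the potential is at least
   exp(s L tau / 8). *)
have bad : \sum_(x | ~~ (`|D x| <= tau / 8)) rho x < 1.
  have e0 : 0 < expR (s * (L%:R * (tau / 8))) by exact: expR_gt0.
  rewrite -(ltr_pM2r e0) mul1r.
  apply: (@le_lt_trans _ _ (2 * (m%:R + 2) * expR (2 * (s * B) ^+ 2) ^+ L)).
    move: hz; rewrite rhoS; apply: le_trans.
    rewrite mulr_suml big_mkcond /=; apply: ler_sum => x _.
    case: ifP => [|_]; last by rewrite mulr_ge0 // addr_ge0 ?expR_ge0.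
    rewrite -ltNge => hx; rewrite ler_wpM2l // -/(S x) -/(G x) DE.
    have [d0|d0] := leP 0 (D x).
      rewrite ger0_norm // in hx; rewrite ler_wpDr ?expR_ge0 // ler_expR.
      by rewrite ler_wpM2l ?(ltW s0) // ler_wpM2l ?(ltW LR) // ltW.
    rewrite ltr0_norm // in hx; rewrite ler_wpDl ?expR_ge0 // ler_expR -!mulrN.
    by rewrite ler_wpM2l ?(ltW s0) // ler_wpM2l ?(ltW LR) // ltW.
  rewrite -expRM_natl.
  apply: (@lt_le_trans _ _ (expR (L%:R * tau ^+ 2 / (512 * B ^+ 2)) *
     expR (L%:R * (2 * (s * B) ^+ 2)))); first by rewrite ltr_pM2r ?expR_gt0.
  rewrite -expRD ler_expR le_eqVlt (_ : _ == _) //; apply/eqP.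
  by rewrite /s; field; rewrite gt_eqF.
split.
  move=> x xxi; apply: contraT => hx; move: bad; apply: contraTT => _.
  rewrite -leNgt (bigD1 x) //= ler_wpDr ?sumr_ge0 //.
  rewrite /rho ler_wpDr //; last by rewrite -has_pred1 has_count in xxi; rewrite ler1n.
  by rewrite mulr_ge0 ?divr_ge0 ?(ltW wA) //; case: ifP.
have : \sum_(x | A x && ~~ (`|D x| <= tau / 8)) w x <= W / 2.
  apply/ltW; rewrite -(@ltr_pM2l _ (2 / W)) ?divr_gt0 //.
  rewrite (_ : 2 / W * (W / 2) = 1); last by field; rewrite gt_eqF.
  apply: le_lt_trans bad; rewrite mulr_sumr [leRHS]big_mkcond [leLHS]big_mkcond /=.
  apply: ler_sum => x _; rewrite andbC; case: (~~ _) => //=.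
  case: ifP => Ax; last exact: rho0.
  by rewrite /rho Ax ler_wpDl.
have : W = \sum_(x | A x && (`|D x| <= tau / 8)) w x +
   \sum_(x | A x && ~~ (`|D x| <= tau / 8)) w x by rewrite /W (bigID (fun x => `|D x| <= tau / 8)).
lra.
Qed.

Lemma ln_ge1BV (R : realType) (x : R) : 0 < x -> 1 - x^-1 <= ln x.
Proof.
by move=> x0; have := expR_ge1Dx (- ln x); rewrite expRN lnK ?posrE //; lra.
Qed.

(** Splitting 2 improves the bound 1/2 of [ln_ge1BV] to 1/4 + 1/3. A value above 1/2 keeps ln 2 + ln
    (ln 2) positive, which [sampling_budget] relies on. *)
Lemma ln2_ge (R : realType) : 7 / 12 <= ln 2 :> R.
Proof.
have -> : 2 = (4 / 3) * (3 / 2) :> R by lra.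
rewrite lnM ?posrE; try lra.
have h1 : 1 - (4 / 3)^-1 <= ln (4 / 3) :> R by apply: ln_ge1BV; lra.
have h2 : 1 - (3 / 2)^-1 <= ln (3 / 2) :> R by apply: ln_ge1BV; lra.
lra.
Qed.

(** Here [t2] is tau^2, [B2] is B^2, [lJ] the entropy per Maurey term and [L] the rounded number of
    terms. The entropy [L * lJ] of one level, plus a slack [T] for the union over levels, has to fit
    into [m] times half the guaranteed mass. *)
Lemma level_budget (R : realType) (B2 T Lam lJ m t2 L : R) :
  0 < t2 -> t2 <= B2 -> 1 <= T -> 1 <= Lam -> 1 / 2 <= lJ ->
  5500 * T ^+ 2 * B2 * Lam * lJ <= m -> L * t2 <= 512 * B2 * Lam + t2 ->
  L * lJ + T <= m * (3 / (16 * t2 * T) / 2).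
Proof.
move=> t0 tB T1 L1 J1 hm hL.
have B0 : 0 < B2 by exact: lt_le_trans tB.
have T0 : 0 < T by exact: lt_le_trans T1.
have J0 : 0 < lJ by apply: lt_le_trans J1.
have -> : m * (3 / (16 * t2 * T) / 2) = (3 * m / (32 * T)) / t2.
  by field; rewrite !gt_eqF.
rewrite ler_pdivlMr // ler_pdivlMr ?mulr_gt0 //.
pose X := B2 * Lam * lJ.
have BX : B2 <= 2 * X.
  have : B2 * 1 <= B2 * (2 * (Lam * lJ)).
    rewrite ler_wpM2l ?(ltW B0) //.
    have : 1 * (1 / 2) <= Lam * lJ by apply: ler_pM.
    clear; lra.
  by rewrite /X mulr1 mulrCA !mulrA.
have h1 : L * t2 * lJ <= (512 * B2 * Lam + t2) * lJ by rewrite ler_wpM2r // ltW.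
have h2 : t2 * lJ <= X.
  rewrite /X ler_wpM2r ?(ltW J0) //; apply: (le_trans tB).
  by rewrite -[leLHS]mulr1 ler_wpM2l // ltW.
have h3 : t2 * T <= 2 * X * T by rewrite ler_wpM2r ?(ltW T0) // (le_trans tB).
have X0 : 0 <= X by rewrite /X !mulr_ge0 // ltW // (lt_le_trans ltr01).
have h4 : X * 1 <= X * T by rewrite ler_wpM2l.
(* 512 comes from the Maurey length, 1 from its rounding and 2 from the slack; 515 * 32 <= 3 * 5500
   explains the constant 5500. *)
have h5 : (L * lJ + T) * t2 <= 515 * (X * T).
  have e : (512 * B2 * Lam + t2) * lJ = 512 * X + t2 * lJ by rewrite /X; ring.
  move: h1 h2 h3 h4; rewrite e; clear; lra.
apply: (@le_trans _ _ (515 * (X * T) * (32 * T))).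
  by rewrite ler_wpM2r // mulr_ge0 // ltW.
apply: (@le_trans _ _ (3 * (5500 * T ^+ 2 * B2 * Lam * lJ))); last by rewrite ler_pM2l.
have -> : 3 * (5500 * T ^+ 2 * B2 * Lam * lJ) = 16500 * (X * T * T) by rewrite /X; ring.
have -> : 515 * (X * T) * (32 * T) = 16480 * (X * T * T) by ring.
apply: ler_wpM2r; last by clear; lra.
by apply: mulr_ge0; [apply: mulr_ge0|]; rewrite // ltW.
Qed.

(* A level set {|G| >= tau} of mass about 1 / tau^2 needs about
   tau^2 * T random points per nat of entropy, but to detect it an average of
   only B^2 / tau^2 dictionary terms suffices; the product does not depend on
   the level tau. *)
Lemma exists_sampling_normalized (R : realType) (P J : finType) (w : P -> R)
    (psi : J -> P -> R) (B : R) (T m : nat) (j0 : J) :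
  (forall x, 0 <= w x) -> \sum_x w x = 1 -> (forall j x, `|psi j x| <= 1) ->
  1 <= B -> 2 * B < 2 ^+ T -> 2 ^+ T <= 4 * B ->
  5500 * T%:R ^+ 2 * B ^+ 2 * ln (2 * (m%:R + 2)) * ln (2 * #|J|%:R) <= m%:R ->
  exists xi : m.-tuple P, forall a : J -> R,
    let G x := \sum_j a j * psi j x in
    \sum_j `|a j| <= B -> \sum_x w x * G x ^+ 2 = 1 ->
    exists2 x, x \in xi & 3 / 8 <= `|G x|.
Proof.
move=> w0 w1 psi1 B1 BT TB; set Lam := ln (2 * (m%:R + 2)).
set lJ := ln (2 * #|J|%:R) => hm.
have B0 : 0 < B by exact: lt_le_trans B1.
have T0 : (0 < T)%N.
  rewrite lt0n; apply/eqP => T0; move: BT; rewrite T0 expr0; move: B1; clear; lra.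
have TR : 1 <= T%:R :> R by rewrite ler1n.
have J0 : 1 <= #|J|%:R :> R by rewrite ler1n; apply/card_gt0P; exists j0.
have m0 : 0 <= m%:R :> R by [].
have lJ2 : 1 / 2 <= lJ.
  apply: (@le_trans _ _ (ln 2)); first by have := ln2_ge R; clear; lra.
  by rewrite ler_ln ?posrE ?mulr_gt0 // ?(lt_le_trans ltr01 J0) // ler_peMr.
have Lam1 : 1 <= Lam.
  apply: (@le_trans _ _ (ln (2 * 2))).
    by rewrite lnM ?posrE //; have := ln2_ge R; clear; lra.
  have m2 : 2 <= m%:R + 2 :> R by rewrite lerDr.
  by rewrite ler_ln ?posrE ?mulr_gt0 ?ler_pM2l // (lt_le_trans _ m2).
pose tau (t : nat) : R := 2 ^+ t / 2.
have tau12 t : 1 / 2 <= tau t.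
  by rewrite /tau ler_pM2r ?invr_gt0 // exprn_ege1 // ler1n.
have tau0 t : 0 < tau t by exact: lt_le_trans (tau12 t).
have tauB (t : 'I_T) : tau t <= B.
  have : 2 ^+ t.+1 <= 2 ^+ T :> R by rewrite ler_weXn2l // ler1n.
  by rewrite /tau exprS; move: TB; clear; lra.
have tau2 t : 0 < tau t ^+ 2 by rewrite exprn_gt0.
have TR0 : 0 < T%:R :> R by exact: lt_le_trans TR.
pose p t : R := 3 / (16 * tau t ^+ 2 * T%:R).
have p0 t : 0 < p t by rewrite /p divr_gt0 ?mulr_gt0.
have p1 t : p t <= 1.
  rewrite /p ler_pdivrMr ?mul1r ?mulr_gt0 //.
  have h2 : (1 / 2) ^+ 2 <= tau t ^+ 2 by rewrite ler_pXn2r ?nnegrE ?divr_ge0 // ltW.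
  have : (1 / 2) ^+ 2 * 1 <= tau t ^+ 2 * T%:R by rewrite ler_pM // exprn_ge0.
  by rewrite -mulrA expr2; clear; lra.
(* More than [x0 t] terms make L tau^2 / (512 B^2) exceed [Lam], as the Maurey step requires; the
   successor in [L] makes this strict. *)
pose x0 t : R := 512 * B ^+ 2 / tau t ^+ 2 * Lam.
pose L t := (Num.truncn (x0 t)).+1.
have B2 : 0 < B ^+ 2 by rewrite exprn_gt0.
have x0E t : x0 t * tau t ^+ 2 = 512 * B ^+ 2 * Lam.
  by rewrite /x0; field; rewrite gt_eqF.
have x00 t : 0 <= x0 t.
  apply: mulr_ge0; last exact: le_trans Lam1.
  apply: divr_ge0; last exact: ltW.
  by apply: mulr_ge0; [exact: ler0n|exact: ltW].
have key (t : 'I_T) : (L t)%:R * lJ + T%:R <= m%:R * (p t / 2).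
  apply: level_budget hm _ => //; first by rewrite ler_pXn2r ?nnegrE ?(ltW (tau0 t)) ?(ltW B0).
  rewrite -(x0E t) -[X in _ + X]mul1r -mulrDl ler_wpM2r ?(ltW (tau2 t)) //.
  by rewrite /L -natr1 lerD2r truncn_le.
move: hm => _.
pose I := {t : 'I_T & (L t).-tuple (J * bool)}.
pose h (i : I) x := (\sum_(u <- tagged i) signed_atom psi B u x) / (L (tag i))%:R.
pose E (i : I) : pred P := fun x => 7 / 8 * tau (tag i) <= `|h i x|.
pose pI (i : I) := p (tag i) / 2.
(* A candidate average whose large set is too light need not be hit, so it gets weight 0; the others
   count 1. *)
pose c (i : I) : R := if pI i <= \sum_(x | E i x) w x then 1 else 0.
have [||||xi hxi] := @exists_hitting_tuple R P I w E pI c m w0 w1.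
- by move=> i; rewrite /c; case: ifP.
- by move=> i; rewrite /pI; have := p1 (tag i); have := p0 (tag i); clear; lra.
- by move=> i; rewrite /c; case: ifP => [?|_]; rewrite ?mul1r ?mul0r.
(* Level [t] has (2|J|)^L candidates, each missed with weight at most exp(- m p / 2), so it
   contributes at most e^(-T); and T e^(-T) < 1. *)
- apply: (@le_lt_trans _ _ (\sum_(t < T) expR (- T%:R))).
    apply: (@le_trans _ _ (\sum_(i : I) (1 - p (tag i) / 2) ^+ m)).
      apply: ler_sum => i _; rewrite -[leRHS]mul1r ler_wpM2r //.
        by rewrite exprn_ge0 // /pI; have := p1 (tag i); clear; lra.
      by rewrite /c; case: ifP.
    rewrite -(sig_big_dep xpredT (fun _ => xpredT)
       (fun (t : 'I_T) (z : (L t).-tuple (J * bool)) => (1 - p t / 2) ^+ m)) /=.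
    apply: ler_sum => t _; rewrite sumr_const card_tuple card_prod card_bool.
    rewrite -[leLHS]mulr_natl natrX natrM [#|J|%:R * _]mulrC.
    have -> : (2 * #|J|%:R) ^+ L t = expR ((L t)%:R * lJ) :> R.
      by rewrite expRM_natl lnK // posrE mulr_gt0 // (lt_le_trans ltr01).
    apply: (@le_trans _ _ (expR ((L t)%:R * lJ) * expR (m%:R * - (p t / 2)))).
      rewrite ler_wpM2l ?expR_ge0 // expRM_natl.
      apply: lerXn2r; rewrite ?nnegrE ?expR_ge0 //.
        by have := p1 t; clear; lra.
      by have := expR_ge1Dx (- (p t / 2)).
    by rewrite -expRD ler_expR; have := key t; clear; lra.
  rewrite sumr_const card_ord -[ltLHS]mulr_natl expRN ltr_pdivrMr ?expR_gt0 // mul1r.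
  by have := expR_ge1Dx (T%:R : R); clear; lra.
exists xi => a G aB D1.
have GB x : `|G x| <= B.
  apply: le_trans (ler_norm_sum _ _ _) _; apply: le_trans aB; apply: ler_sum => j _.
  by rewrite normrM -[leRHS]mulr1 ler_wpM2l.
have [t /= ht] := exists_heavy_level w0 w1 D1 GB BT T0.
rewrite -/(tau t) -/(p t) in ht.
have LR : 0 < (L t)%:R :> R by rewrite ltr0n.
have tau8B : tau t <= 8 * B by apply: (le_trans (tauB t)); rewrite ler_peMl ?(ltW B0) ?ler1n.
have hLt : 2 * (m%:R + 2) < expR ((L t)%:R * tau t ^+ 2 / (512 * B ^+ 2)).
  rewrite -[ltLHS]lnK ?posrE ?mulr_gt0 ?ltr_wpDl //.
  rewrite ltr_expR -/Lam ltr_pdivlMr; last by apply: mulr_gt0; rewrite ?ltr0n.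
  have : x0 t < (L t)%:R by rewrite /L truncnS_gt.
  by rewrite -(ltr_pM2r (tau2 t)) x0E mulrC.
have [z [zxi zA]] := @exists_maurey_average R P J psi B a j0 w
  (fun x => tau t <= `|G x|) (tau t) (L t) m xi psi1 B0 aB w0
  (lt_le_trans (p0 t) ht) (tau0 t) tau8B (ltn0Sn _) hLt.
pose i : I := Tagged (fun t : 'I_T => (L t).-tuple (J * bool)) z.
have hD x : (\sum_(u <- z) signed_atom psi B u x) / (L t)%:R -
   \sum_j a j * psi j x = h i x - G x by [].
(* On at least half of the level set, |h| >= tau - tau / 8, so the large set of this candidate is
   heavy enough to count. *)
have ci : c i = 1.
  rewrite /c ifT //; apply: le_trans (_ : p t / 2 <= _) _; first by rewrite /pI.
  apply: (@le_trans _ _ ((\sum_(x | tau t <= `|G x|) w x) / 2)).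
    by rewrite ler_pM2r ?invr_gt0.
  apply: (le_trans zA); rewrite [leLHS]big_mkcond [leRHS]big_mkcond /=.
  apply: ler_sum => x _; rewrite hD; case: ifP => [/andP[h1 h2]|_].
    rewrite ifT // /E /=.
    have : `|G x| <= `|h i x| + `|h i x - G x|.
      by rewrite -[G x in leLHS](subKr (h i x)); exact: ler_normB.
    move: h1 h2; clear; lra.
  by case: ifP.
(* Missing a single candidate of weight 1 would already bring the missed weight up to 1. *)
have /hasP[x xxi Ex] : has (E i) xi.
  apply: contraLR hxi => hN; rewrite -leNgt (bigD1 i) //= ci ler_wpDr //.
  by apply: sumr_ge0 => k _; rewrite /c; case: ifP.
(* At the node that was hit, |G x| >= 7/8 tau - 1/8 tau = 3/4 tau, and tau >= 1/2. *)
exists x => //; have := zxi _ xxi; rewrite hD; move: Ex; rewrite /E /= => h1 h2.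
have : `|h i x| <= `|G x| + `|h i x - G x|.
  by rewrite -[h i x in leLHS](subrK (G x)) addrC; exact: ler_normD.
move: h1 h2 (tau12 t); clear; lra.
Qed.

(** Concavity of the logarithm; a well chosen tangent point trades ln m for a small multiple of
    m. *)
Lemma ln_le_tangent (R : realType) (x y : R) : 0 < x -> 0 < y ->
  ln x <= ln y + x / y - 1.
Proof.
move=> x0 y0; have yx : 0 < y / x by rewrite divr_gt0.
have := ln_ge1BV yx; rewrite ln_div ?posrE // invf_div; clear; lra.
Qed.

(** The requirement on [m] has ln m on its smaller side. With A a constant times v ln N (ln 2v)^2,
    the tangent of ln at 12A bounds that side by A ln (12A) + (m + 2) / 6 - A. The hypothesis makes
    the first term at most m / 2, and (m + 2) / 6 <= m / 2 since m >= 1. *)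
Lemma sampling_budget (R : realType) (K : R) : 1 <= K ->
  exists2 C : R, 0 < C & forall v N m : nat,
    (1 <= v)%N -> (2 <= N)%N -> (1 <= m)%N ->
    C * v%:R * ln N%:R * (ln (2 * v%:R)) ^+ 2 * (ln (2 * v%:R) + ln (ln N%:R))
      <= m%:R ->
    exists T : nat, let B := Num.sqrt (8 * v%:R * K) in
      [/\ 2 * B < 2 ^+ T, 2 ^+ T <= 4 * B &
        5500 * T%:R ^+ 2 * B ^+ 2 * ln (2 * (m%:R + 2)) * ln (2 * (N * 2)%:R)
          <= m%:R].
Proof.
move=> K1; have K0 : 0 < K by exact: lt_le_trans K1.
pose c1 : R := 2 * ln (64 * K) + 1.
have lK0 : 0 <= ln (64 * K) by rewrite ln_ge0 // mulr_ege1 // ler1n.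
have c11 : 1 <= c1 by rewrite /c1 lerDr mulr_ge0.
have c10 : 0 < c1 by exact: lt_le_trans c11.
pose A0 : R := 5500 * 24 * c1 ^+ 2 * K.
have A01 : 1 <= A0.
  have h0 : 1 <= c1 ^+ 2 * K by rewrite mulr_ege1 // exprn_ege1.
  by rewrite /A0 -mulrA mulr_ege1 // mulr_ege1 // ler1n.
have A00 : 0 < A0 by exact: lt_le_trans A01.
have lA0 : 0 <= ln (12 * A0).
  by rewrite ln_ge0 // mulr_ege1 // ler1n.
pose c2 : R := 7 * ln (12 * A0) + 13.
have c20 : 0 < c2 by rewrite /c2; move: lA0; clear; lra.
have A0E : A0 = 5500 * 24 * c1 ^+ 2 * K by [].
have c1E : c1 = 2 * ln (64 * K) + 1 by [].
have c2E : c2 = 7 * ln (12 * A0) + 13 by [].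
clearbody A0 c1 c2.
exists (2 * A0 * c2); first by rewrite mulr_gt0 ?mulr_gt0.
move=> v N m v1 N2 m1 hm; pose B := Num.sqrt (8 * v%:R * K).
set l := ln (2 * v%:R) in hm; set n := ln N%:R in hm; set Y := l + ln n in hm.
have vR : 1 <= v%:R :> R by rewrite ler1n.
have v0 : 0 < v%:R :> R by exact: lt_le_trans vR.
have NR : 2 <= N%:R :> R by rewrite (ler_nat R 2).
have N0 : 0 < N%:R :> R by exact: lt_le_trans NR.
have mR : 1 <= m%:R :> R by rewrite ler1n.
have m0 : 0 < m%:R :> R by exact: lt_le_trans mR.
have ln2l : ln 2 <= l by rewrite /l ler_ln ?posrE ?mulr_gt0 // ler_peMr.
have ln2n : ln 2 <= n by rewrite /n ler_ln ?posrE.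
have l12 : 7 / 12 <= l by exact: le_trans (ln2_ge R) ln2l.
have n12 : 7 / 12 <= n by exact: le_trans (ln2_ge R) ln2n.
have l0 : 0 < l by move: l12; clear; lra.
have n0 : 0 < n by move: n12; clear; lra.
have lnn : ln (7 / 12) <= ln n by rewrite ler_ln ?posrE //; clear; lra.
(* ln (ln N) is negative for N = 2; still, [Y] is at least ln 2 + ln (7/12) = ln (7/6) >= 1/7. *)
have Y7 : 1 / 7 <= Y.
  apply: (@le_trans _ _ (ln 2 + ln (7 / 12))); last by rewrite lerD.
  rewrite -lnM ?posrE; [|clear; lra|clear; lra].
  have : 1 - (2 * (7 / 12))^-1 <= ln (2 * (7 / 12)) :> R.
    by apply: ln_ge1BV; clear; lra.
  clear; lra.
(* Here - ln n <= 5/7 <= 5 Y, and l = Y - ln n. *)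
have lY : l <= 6 * Y.
  have : 1 - (7 / 12)^-1 <= ln (7 / 12) :> R by apply: ln_ge1BV; clear; lra.
  move: lnn Y7; rewrite /Y; clear; lra.
have B2 : B ^+ 2 = 8 * v%:R * K by rewrite sqr_sqrtr // !mulr_ge0 // ltW.
have Bgt0 : 0 < B by rewrite sqrtr_gt0 !mulr_gt0.
have B1 : 1 <= B.
  have : 1 ^+ 2 <= B ^+ 2.
    rewrite B2 expr1n; have : 1 <= v%:R * K by rewrite mulr_ege1.
    clear; lra.
  by rewrite ler_pXn2r ?nnegrE // ltW.
have ex : exists t, 2 * B < 2 ^+ t.
  exists (Num.truncn (2 * B)).+1; apply: (lt_le_trans (truncnS_gt _)).
  by rewrite -natrX ler_nat ltnW // ltn_expl.
(* Minimality of the exponent yields the upper bound 2^T <= 4B; exponent 0 is excluded by B >= 1. *)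
have [[|t] ht tmin] := ex_minnP ex.
  by move: ht B1; rewrite expr0; clear; lra.
have hT : 2 ^+ t.+1 <= 4 * B.
  have : 2 ^+ t <= 2 * B.
    by rewrite leNgt; apply/negP => /tmin; rewrite ltnn.
  rewrite exprS; clear; lra.
exists t.+1; split=> //; set T := t.+1 in hT *.
have lnB : ln (4 * B) *+ 2 = ln (64 * K) + l.
  rewrite -lnXn ?mulr_gt0 // exprMn B2 -lnM ?posrE ?mulr_gt0 //.
  by congr ln; ring.
have Tl : T%:R <= c1 * l.
  have h1 : ln 2 *+ T <= ln (4 * B).
    by rewrite -lnXn // ler_ln ?posrE ?exprn_gt0 ?mulr_gt0.
  have h2 : 7 / 12 * T%:R <= ln (4 * B).
    apply: le_trans h1; rewrite -[leRHS]mulr_natr ler_wpM2r //; exact: ln2_ge.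
  have h3 : ln (64 * K) * (7 / 12) <= ln (64 * K) * l by rewrite ler_wpM2l.
  move: lnB h2 h3 l0 lK0; rewrite mulr2n c1E; clear; lra.
have T2 : T%:R ^+ 2 <= c1 ^+ 2 * l ^+ 2.
  by rewrite -exprMn ler_pXn2r ?nnegrE // mulr_ge0 // ltW.
have lN : ln (2 * (N * 2)%:R) <= 3 * n.
  rewrite natrM (_ : 2 * (N%:R * 2%:R) = 2 * 2 * N%:R); last by ring.
  rewrite !lnM ?posrE ?mulr_gt0 // -/n; move: ln2n; clear; lra.
have [A AE] : exists A, A = A0 * (v%:R * n * l ^+ 2) by eexists.
have A_gt0 : 0 < A by rewrite AE !mulr_gt0 // exprn_gt0.
set Lam := ln (2 * (m%:R + 2)).
have Lam0 : 0 <= Lam.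
  rewrite /Lam ln_ge0 //; move: mR; clear; lra.
have step1 : 5500 * T%:R ^+ 2 * B ^+ 2 * Lam * ln (2 * (N * 2)%:R) <= A * Lam.
  have -> : A * Lam = (5500 * B ^+ 2 * Lam) * ((c1 ^+ 2 * l ^+ 2) * (3 * n)).
    by rewrite AE A0E B2; ring.
  rewrite [leLHS](_ : _ = (5500 * B ^+ 2 * Lam) * (T%:R ^+ 2 * ln (2 * (N * 2)%:R))); last by ring.
  apply: ler_wpM2l.
    apply: mulr_ge0; last exact: Lam0.
    by apply: mulr_ge0; [exact: ler0n|exact: sqr_ge0].
  apply: ler_pM => //.
  rewrite ln_ge0 // natrM; move: NR; clear; lra.
apply: (le_trans step1).
(* ln (12A) = ln q + ln v + ln n + 2 ln l <= ln q + Y + 2l. With 1 <= 7Y and l <= 6Y this is at most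
   (7 ln q + 13) Y, whence [c2]. *)
have lA : ln (12 * A) <= c2 * Y.
  have [q q0 qE] : exists2 q, 0 < q & q = 12 * A0 by eexists; last reflexivity; rewrite mulr_gt0.
  rewrite AE mulrA c2E -qE lnM ?posrE ?mulr_gt0 ?exprn_gt0 //.
  rewrite lnM ?posrE ?mulr_gt0 ?exprn_gt0 // lnM ?posrE ?mulr_gt0 // lnXn //.
  have h1 : ln v%:R <= l.
    by rewrite ler_ln ?posrE ?mulr_gt0 // ler_peMl ?ler1n // ltW.
  have h2 : ln l < l by exact: ln_sublinear.
  have h3 : ln q * (1 / 7) <= ln q * Y by rewrite ler_wpM2l // qE.
  move: h1 h2 h3 lY; rewrite mulr2n /Y; clear; lra.
have hLam : Lam <= ln (12 * A) + (2 * (m%:R + 2)) / (12 * A) - 1.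
  apply: ln_le_tangent; last by rewrite mulr_gt0.
  move: m0; clear; lra.
apply: (le_trans (ler_wpM2l (ltW A_gt0) hLam)).
have -> : A * (ln (12 * A) + 2 * (m%:R + 2) / (12 * A) - 1) =
    A * ln (12 * A) + (m%:R + 2) / 6 - A by field; rewrite gt_eqF.
have h4 : A * ln (12 * A) <= A * (c2 * Y) by rewrite ler_wpM2l // ltW.
have h5 : 2 * (A * (c2 * Y)) <= m%:R.
  by apply: le_trans hm; rewrite le_eqVlt; apply/orP; left; apply/eqP; rewrite AE; ring.
move: h4 h5 mR A_gt0; clear; lra.
Qed.

(** * Complex-valued dictionaries *)

Lemma cabs_sqr (R : realType) (z : R[i]) :
  cabs z ^+ 2 = complex.Re z ^+ 2 + complex.Im z ^+ 2.
Proof. by case: z => a b; rewrite /cabs /= sqr_sqrtr // addr_ge0 ?sqr_ge0. Qed.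

Lemma cabs_ge0 (R : realType) (z : R[i]) : 0 <= cabs z.
Proof. by case: z => a b; rewrite /cabs /= sqrtr_ge0. Qed.

Lemma cabsD (R : realType) (y z : R[i]) : cabs (y + z) <= cabs y + cabs z.
Proof. exact: le_normcD. Qed.

Lemma cabsM (R : realType) (y z : R[i]) : cabs (y * z) = cabs y * cabs z.
Proof. exact: ComplexField.Normc.normcM. Qed.

Lemma cabsN (R : realType) (z : R[i]) : cabs (- z) = cabs z.
Proof. exact: normcN. Qed.

Lemma cabs0 (R : realType) : cabs (0 : R[i]) = 0.
Proof. exact: ComplexField.Normc.normc0. Qed.

Lemma cabs_sum (R : realType) (I : finType) (A : pred I) (F : I -> R[i]) :
  cabs (\sum_(i | A i) F i) <= \sum_(i | A i) cabs (F i).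
Proof.
elim/big_rec2: _ => [|i x y _ h]; first by rewrite cabs0.
by apply: (le_trans (cabsD _ _)); rewrite lerD2l.
Qed.

Lemma ler_normRe (R : realType) (z : R[i]) : `|complex.Re z| <= cabs z.
Proof.
rewrite -(@ler_pXn2r _ 2) ?nnegrE ?cabs_ge0 // cabs_sqr real_normK ?num_real //.
by rewrite lerDl sqr_ge0.
Qed.

Lemma ler_normIm (R : realType) (z : R[i]) : `|complex.Im z| <= cabs z.
Proof.
rewrite -(@ler_pXn2r _ 2) ?nnegrE ?cabs_ge0 // cabs_sqr real_normK ?num_real //.
by rewrite lerDr sqr_ge0.
Qed.

Lemma complexReImE (R : realType) (z y : R[i]) :
  (complex.Re (z + y) = complex.Re z + complex.Re y) *
  (complex.Im (z + y) = complex.Im z + complex.Im y) *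
  (complex.Re (z * y) = complex.Re z * complex.Re y - complex.Im z * complex.Im y) *
  (complex.Im (z * y) = complex.Re z * complex.Im y + complex.Im z * complex.Re y).
Proof. by case: z => a b; case: y => c d. Qed.

Lemma Re_sum (R : realType) (I : finType) (A : pred I) (F : I -> R[i]) :
  complex.Re (\sum_(i | A i) F i) = \sum_(i | A i) complex.Re (F i).
Proof. by elim/big_rec2: _ => // i x y _ <-; rewrite complexReImE. Qed.

Lemma Im_sum (R : realType) (I : finType) (A : pred I) (F : I -> R[i]) :
  complex.Im (\sum_(i | A i) F i) = \sum_(i | A i) complex.Im (F i).
Proof. by elim/big_rec2: _ => // i x y _ <-; rewrite complexReImE. Qed.

(** Cauchy-Schwarz against the constant 1, read off from the nonnegative double sum of (F_i -
    F_j)^2. *)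
Lemma sqr_sum_le (R : realType) (I : finType) (A : pred I) (F : I -> R) :
  (\sum_(i | A i) F i) ^+ 2 <= #|A|%:R * \sum_(i | A i) F i ^+ 2.
Proof.
have : 0 <= \sum_(i | A i) \sum_(j | A j) (F i - F j) ^+ 2.
  by do 2 (apply: sumr_ge0 => ? _); exact: sqr_ge0.
have -> : \sum_(i | A i) \sum_(j | A j) (F i - F j) ^+ 2 =
  2 * (#|A|%:R * \sum_(i | A i) F i ^+ 2) - 2 * (\sum_(i | A i) F i) ^+ 2.
  under eq_bigr => i _.
    rewrite (eq_bigr (fun j => F i ^+ 2 + F j ^+ 2 - 2 * F i * F j)); last by move=> j _; ring.
    rewrite sumrB big_split /= sumr_const -mulr_sumr -[F i ^+ 2 *+ _]mulr_natl; over.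
  rewrite sumrB big_split /= sumr_const -mulr_sumr -mulr_suml -mulr_sumr -[(\sum_(i | A i) F i ^+ 2) *+ _]mulr_natl.
  ring.
clear; lra.
Qed.

(** The homogeneous form of the normalized statement: divide [a] by the root of the mean square. The
    factor 64/9 is the square of 8/3. *)
Lemma exists_sampling (R : realType) (P J : finType) (w : P -> R)
    (psi : J -> P -> R) (B : R) (T m : nat) (j0 : J) :
  (forall x, 0 <= w x) -> \sum_x w x = 1 -> (forall j x, `|psi j x| <= 1) ->
  1 <= B -> 2 * B < 2 ^+ T -> 2 ^+ T <= 4 * B ->
  5500 * T%:R ^+ 2 * B ^+ 2 * ln (2 * (m%:R + 2)) * ln (2 * #|J|%:R) <= m%:R ->
  exists xi : m.-tuple P, forall (a : J -> R) (b : R),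
    let G x := \sum_j a j * psi j x in
    (\sum_j `|a j|) ^+ 2 <= B ^+ 2 * \sum_x w x * G x ^+ 2 ->
    (forall x, x \in xi -> `|G x| <= b) ->
    \sum_x w x * G x ^+ 2 <= 64 / 9 * b ^+ 2.
Proof.
move=> w0 w1 psi1 B1 BT TB hm.
have [xi hxi] := exists_sampling_normalized j0 w0 w1 psi1 B1 BT TB hm.
exists xi => a b G aB Gb; pose D := \sum_x w x * G x ^+ 2; rewrite -/D in aB *.
have D0 : 0 <= D by rewrite /D; apply: sumr_ge0 => x _; apply: mulr_ge0; rewrite ?sqr_ge0.
have [D_eq0|D_gt0] := eqVneq D 0.
  by rewrite D_eq0; apply: mulr_ge0; [apply: divr_ge0; exact: ler0n|exact: sqr_ge0].
have {D_gt0 D0} D0 : 0 < D by rewrite lt_def D_gt0.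
pose r := Num.sqrt D; have r0 : 0 < r by rewrite sqrtr_gt0.
have r2 : r ^+ 2 = D by rewrite sqr_sqrtr // ltW.
have GE x : \sum_j a j / r * psi j x = G x / r.
  by rewrite /G mulr_suml; apply: eq_bigr => j _; rewrite mulrAC.
have [||x xxi] := hxi (fun j => a j / r).
- under eq_bigr do rewrite normrM normfV (gtr0_norm r0).
  rewrite -mulr_suml ler_pdivrMr // -(@ler_pXn2r _ 2) ?nnegrE ?sumr_ge0 //.
    by rewrite exprMn r2.
  by apply: mulr_ge0; [exact: le_trans B1|exact: ltW].
- under eq_bigr do rewrite GE exprMn exprVn r2 mulrA.
  by rewrite -mulr_suml -/D mulfV // gt_eqF.
rewrite GE normrM normfV (gtr0_norm r0) ler_pdivlMr // => h.
have h2 : 3 / 8 * r <= b by exact: le_trans h (Gb _ xxi).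
have : (3 / 8 * r) ^+ 2 <= b ^+ 2.
  have h3 : 0 <= 3 / 8 * r by apply: mulr_ge0; [apply: divr_ge0; exact: ler0n|exact: ltW].
  by rewrite ler_pXn2r ?nnegrE // (le_trans h3).
rewrite exprMn r2; clear; lra.
Qed.

(* Complex-valued functions on P are real-valued functions on P * bool (real
   and imaginary parts), with dictionary phi_j, i phi_j. *)
Lemma exists_sparse_sampling (R : realType) (P : finType) (w : P -> R) (N v m T : nat)
    (phi : 'I_N -> P -> R[i]) (K : R) :
  (forall x, 0 <= w x) -> \sum_x w x = 1 -> (forall j x, cabs (phi j x) <= 1) ->
  1 <= K -> (1 <= v)%N -> (1 <= N)%N ->
  (let B := Num.sqrt (8 * v%:R * K) in
      [/\ 2 * B < 2 ^+ T, 2 ^+ T <= 4 * B &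
        5500 * T%:R ^+ 2 * B ^+ 2 * ln (2 * (m%:R + 2)) * ln (2 * (N * 2)%:R)
          <= m%:R]) ->
  exists xi : m.-tuple P, forall (J : {set 'I_N}) (a : 'I_N -> R[i]) (b : R),
    let g x := \sum_(j in J) a j * phi j x in
    #|J| = v ->
    \sum_(j in J) cabs (a j) ^+ 2 <= 2 * K * \sum_x w x * cabs (g x) ^+ 2 ->
    (forall x, x \in xi -> cabs (g x) <= b) ->
    \sum_x w x * cabs (g x) ^+ 2 <= 15 * b ^+ 2.
Proof.
move=> w0 w1 phi1 K1 v1 N1; set B := Num.sqrt _ => -[BT TB hm].
have K0 : 0 < K by exact: lt_le_trans K1.
have vR : 1 <= v%:R :> R by rewrite ler1n.
have B2 : B ^+ 2 = 8 * v%:R * K by rewrite sqr_sqrtr // !mulr_ge0 // ltW.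
have B1 : 1 <= B.
  rewrite -(@ler_pXn2r _ 2) ?nnegrE ?sqrtr_ge0 // B2 expr1n.
  by rewrite !mulr_ege1 // ler1n.
pose psi (u : 'I_N * bool) (y : P * bool) : R := let z := phi u.1 y.1 in
  if u.2 then (if y.2 then complex.Re z else - complex.Im z)
  else (if y.2 then complex.Im z else complex.Re z).
clearbody B.
(* Halving makes the doubled set a probability space; its mean square is half of that of |g|. *)
pose w' (y : P * bool) := w y.1 / 2.
have [||||xi hxi] := @exists_sampling R _ _ w' psi B T m (Ordinal N1, true) _ _ _ B1 BT TB.
- by case=> x c; rewrite /w' divr_ge0.
- rewrite -(pair_bigA _ (fun x (c : bool) => w x / 2)) /=.
  by apply: etrans w1; apply: eq_bigr => x _; rewrite big_bool /=; field.
- case=> j c [x d]; rewrite /psi /=; apply: le_trans (phi1 j x).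
  by case: c; case: d; rewrite ?normrN ?ler_normRe ?ler_normIm.
- by rewrite card_prod card_ord card_bool.
exists [tuple of map fst xi] => J a b g cJ aK gb.
pose a' (u : 'I_N * bool) : R :=
  if u.1 \in J then (if u.2 then complex.Im (a u.1) else complex.Re (a u.1)) else 0.
have GE y : \sum_u a' u * psi u y = if y.2 then complex.Im (g y.1) else complex.Re (g y.1).
  rewrite -(pair_bigA _ (fun j (c : bool) => a' (j, c) * psi (j, c) y)) /=.
  rewrite /g; case: y => x []; rewrite /= ?Im_sum ?Re_sum [RHS]big_mkcond;
    apply: eq_bigr => j _; rewrite big_bool /a' /psi /=; case: ifP => _;
    rewrite ?complexReImE; ring.
have DE : \sum_y w' y * (\sum_u a' u * psi u y) ^+ 2 =
    (\sum_x w x * cabs (g x) ^+ 2) / 2.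
  rewrite (eq_bigr (fun y => w' y * (if y.2 then complex.Im (g y.1) else complex.Re (g y.1)) ^+ 2));
    last by move=> y _; rewrite GE.
  rewrite -(pair_bigA _ (fun x (c : bool) => w' (x, c) *
     (if c then complex.Im (g x) else complex.Re (g x)) ^+ 2)) /=.
  rewrite mulr_suml; apply: eq_bigr => x _; rewrite big_bool /w' /= cabs_sqr.
  by field.
(* Undoing the halving costs a factor 2, and 2 * 64/9 <= 15. *)
suff : \sum_y w' y * (\sum_u a' u * psi u y) ^+ 2 <= 64 / 9 * b ^+ 2.
  rewrite DE => h; have := sqr_ge0 b; move: h.
  set X := \sum_x w x * cabs (g x) ^+ 2; clear; lra.
apply: hxi.
(* There are 2v real coefficients, so the squared l1 norm is at most 2v * 2K D = 8vK (D / 2), with D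
   the mean square of |g|. This is the choice of [B]. *)
- rewrite DE B2; pose S : pred ('I_N * bool) := fun u => u.1 \in J.
  have -> : \sum_u `|a' u| = \sum_(u | S u) `|a' u|.
    rewrite [RHS]big_mkcond; apply: eq_bigr => u _; rewrite /S /a'.
    by case: ifP => //; rewrite normr0.
  apply: (le_trans (sqr_sum_le _ _)).
  have -> : #|S| = (v * 2)%N.
    rewrite -cJ -card_bool -cardX; apply: eq_card => -[j c].
    by rewrite !inE andbT.
  have -> : \sum_(u | S u) `|a' u| ^+ 2 = \sum_(j in J) cabs (a j) ^+ 2.
    rewrite big_mkcond -(pair_bigA _ (fun j (c : bool) =>
      if S (j, c) then `|a' (j, c)| ^+ 2 else 0)) [RHS]big_mkcond /=.
    apply: eq_bigr => j _; rewrite big_bool /S /a' /=; case: (j \in J); last by rewrite addr0.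
    by rewrite !real_normK ?num_real // cabs_sqr addrC.
  rewrite natrM; set X := \sum_x w x * cabs (g x) ^+ 2 in aK *.
  have -> : 8 * v%:R * K * (X / 2) = v%:R * 2 * (2 * K * X) by field.
  by apply: ler_wpM2l aK; apply: mulr_ge0; exact: ler0n.
- case=> x c xxi; rewrite GE /=.
  have /gb h : x \in [tuple of map fst xi] by apply/mapP; exists (x, c).
  by apply: le_trans h; case: c {xxi}; [exact: ler_normIm|exact: ler_normRe].
Qed.

(** * Dominated extension *)

Section DominatedExtension.
Variables (R : realType) (U : Type) (add : U -> U -> U) (scale : R -> U -> U).
Variables (V : set U) (p : U -> R).
Hypotheses (VD : forall f g, V f -> V g -> V (add f g))
  (VZ : forall (c : R) f, V f -> V (scale c f))
  (pD : forall f g, V f -> V g -> p (add f g) <= p f + p g)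
  (pZ : forall (c : R) f, V f -> 0 <= c -> p (scale c f) = c * p f).

Definition linear_on (l : U -> R) :=
  (forall f g, V f -> V g -> l (add f g) = l f + l g) /\
  (forall c f, V f -> l (scale c f) = c * l f).

(* One Hahn-Banach step: the admissible multipliers of the last functional
   form an interval, nonempty since the sum of f and g lies in its kernel whenever it takes
   the values 1 at f and -1 at g. *)
Lemma dominated_extension (n : nat) (e : 'I_n -> U -> R) (l : U -> R) :
  (forall i, linear_on (e i)) -> linear_on l ->
  (forall f, V f -> (forall i, e i f = 0) -> l f <= p f) ->
  exists lam : 'I_n -> R, forall f, V f -> l f - \sum_i lam i * e i f <= p f.
Proof.
elim: n e l => [|n IH] e l el [lD lZ] lp.
  by exists (fun=> 0) => f Vf; rewrite big_ord0 subr0; apply: lp => // -[].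
have [e0D e0Z] := el ord0.
(* The first multiplier only has to work on the common kernel of the other functionals; induction
   then treats these with [l - lam0 * e ord0] in place of [l]. *)
suff [lam0 hlam0] : exists lam0 : R, forall f, V f ->
    (forall i, e (lift ord0 i) f = 0) -> l f - lam0 * e ord0 f <= p f.
  have [|| |lam hlam] := IH (fun i => e (lift ord0 i)) (fun f => l f - lam0 * e ord0 f).
  - by move=> i; exact: el.
  - split=> [f g Vf Vg|c f Vf]; first by rewrite lD // e0D //; ring.
    by rewrite lZ // e0Z //; ring.
  - exact: hlam0.
  exists (fun i => if unlift ord0 i is Some j then lam j else lam0) => f Vf.
  rewrite big_ord_recl unlift_none opprD addrA.
  under eq_bigr do rewrite liftK.
  exact: hlam.
pose K f := V f /\ forall i, e (lift ord0 i) f = 0.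
have KD f g : K f -> K g -> K (add f g).
  move=> [Vf Kf] [Vg Kg]; split; first exact: VD.
  by move=> i; have [eD _] := el (lift ord0 i); rewrite eD // Kf Kg addr0.
have KZ c f : K f -> K (scale c f).
  move=> [Vf Kf]; split; first exact: VZ.
  by move=> i; have [_ eZ] := el (lift ord0 i); rewrite eZ // Kf mulr0.
have ker f : K f -> e ord0 f = 0 -> l f <= p f.
  move=> [Vf Kf] e0f; apply: lp => // i.
  by case: (unliftP ord0 i) => [j|] ->.
have compat f g : K f -> K g -> e ord0 f = 1 -> e ord0 g = -1 ->
    l f - p f <= p g - l g.
  move=> Kf Kg ef eg; have [Vf _] := Kf; have [Vg _] := Kg.
  have := ker _ (KD _ _ Kf Kg); rewrite e0D // ef eg subrr => /(_ erefl).
  rewrite lD //; have := pD Vf Vg; lra.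
(* If the first functional vanishes on that kernel, any multiplier works and 0 is taken. *)
have [[f1 [Kf1 ef1]]|none] := pselect (exists f, K f /\ e ord0 f = 1); last first.
  exists 0 => f Vf Kf; rewrite mul0r subr0; apply: ker => //.
  apply/eqP; apply: contrapT => /negP e0; apply: none.
  exists (scale (e ord0 f)^-1 f); split; first exact: KZ.
  by rewrite e0Z // mulVf.
pose A := [set l f - p f | f in [set f | K f /\ e ord0 f = 1]].
have KNf1 : K (scale (-1) f1) by exact: KZ.
have eNf1 : e ord0 (scale (-1) f1) = -1.
  by rewrite e0Z; [rewrite ef1 mulr1|case: Kf1].
have supA : has_sup A.
  split; first by exists (l f1 - p f1), f1.
  by exists (p (scale (-1) f1) - l (scale (-1) f1)) => _ [f [Kf ef] <-]; exact: compat.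
(* [sup A] is the left end of the interval of admissible multipliers. By homogeneity only the values
   1, -1 and 0 of the first functional matter. *)
exists (sup A) => f Vf Kf0; have Kf : K f by [].
have [e0|e0|e0] := ltgtP (e ord0 f) 0.
- pose c := - (e ord0 f)^-1.
  have c0 : 0 < c by rewrite oppr_gt0 invr_lt0.
  have eg : e ord0 (scale c f) = -1.
    by rewrite e0Z // mulNr mulVf // lt_eqF.
  have : sup A <= p (scale c f) - l (scale c f).
    apply: ge_sup; first by case: supA.
    by move=> _ [h [Kh eh] <-]; apply: compat => //; exact: KZ.
  rewrite pZ ?(ltW c0) // lZ // -mulrBr -ler_pdivrMl // /c invrN invrK.
  lra.
- pose c := (e ord0 f)^-1.
  have c0 : 0 < c by rewrite invr_gt0.
  have eg : e ord0 (scale c f) = 1 by rewrite e0Z // mulVf // gt_eqF.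
  have : l (scale c f) - p (scale c f) <= sup A.
    by apply: sup_upper_bound => //; exists (scale c f) => //; split=> //; exact: KZ.
  rewrite pZ ?(ltW c0) // lZ // -mulrBr -ler_pdivlMl // /c invrK.
  lra.
- by rewrite e0 mulr0 subr0; exact: ker.
Qed.

End DominatedExtension.

(** * Integration of continuous functions on a compact set *)

Section IntegrationOnCompact.
Variables (R : realType) (d : nat) (Omega : set 'rV[R]_d).
Variable mu : probability (borelRd R d) R.
Hypotheses (cOmega : compact Omega) (mu1 : mu Omega = 1%E).

Lemma borel_open (U : set 'rV[R]_d) : open U -> measurable (U : set (borelRd R d)).
Proof. by move=> oU; apply: sub_sigma_algebra. Qed.

Lemma borel_compact : measurable (Omega : set (borelRd R d)).
Proof.
have /closed_openC/borel_open/measurableC := compact_closed (@norm_hausdorff _ _) cOmega.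
by rewrite setCK.
Qed.

Lemma within_continuous_measurable (F : 'rV[R]_d -> R) :
  {within Omega, continuous F} -> measurable_fun (Omega : set (borelRd R d)) F.
Proof.
move=> /continuousP cF; apply: (measurability _ (measurable_realfun.RGenOpens.measurableE R)).
move=> _ [_ [a [b ->] <-]].
have /cF/open_subspaceP [V oV VE] : open `]a, b[%classic by exact: interval_open.
rewrite setIC -VE; apply: measurableI; last exact: borel_compact.
exact: borel_open.
Qed.

Lemma within_continuous_integrable (F : 'rV[R]_d -> R) :
  {within Omega, continuous F} -> mu.-integrable Omega (EFin \o F).
Proof.
move=> cF; apply: measurable_bounded_integrable.
- exact: borel_compact.
- exact: le_lt_trans (probability_le1 mu borel_compact) (ltry _).
- exact: within_continuous_measurable.
- have [M [Mr hM]] := compact_bounded (continuous_compact cF cOmega).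
  exists M; split=> // x Mx y Oy /=; apply: (hM x Mx).
  by exists y.
Qed.

Lemma ccontinuous_near (f : 'rV[R]_d -> R[i]) (x : 'rV[R]_d) (e : R) :
  ccontinuous_on Omega f -> Omega x -> 0 < e ->
  \forall y \near x, Omega y -> cabs (f x - f y) < e.
Proof.
move=> cf Ox e0; have [del del0 h] := cf x Ox e e0.
by apply/nbhs_normP; exists del => // y xy Oy; apply: h.
Qed.

Lemma ccontinuous_lipschitz (f : 'rV[R]_d -> R[i]) (F : 'rV[R]_d -> R) :
  ccontinuous_on Omega f -> (forall x y, `|F x - F y| <= cabs (f x - f y)) ->
  {within Omega, continuous F}.
Proof.
move=> cf hF; apply/subspace_continuousP => x Ox.
apply/cvgrPdist_lt => e e0; rewrite near_withinE.
near=> y => Oy; apply: (le_lt_trans (hF x y)); move: Oy; near: y.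
exact: ccontinuous_near.
Unshelve. all: by end_near. Qed.

Lemma within_continuous_Re (f : 'rV[R]_d -> R[i]) :
  ccontinuous_on Omega f -> {within Omega, continuous (fun x => complex.Re (f x))}.
Proof.
move=> cf; apply: (ccontinuous_lipschitz cf) => x y.
by apply: le_trans (ler_normRe _); case: (f x) => a b; case: (f y).
Qed.

Lemma within_continuous_Im (f : 'rV[R]_d -> R[i]) :
  ccontinuous_on Omega f -> {within Omega, continuous (fun x => complex.Im (f x))}.
Proof.
move=> cf; apply: (ccontinuous_lipschitz cf) => x y.
by apply: le_trans (ler_normIm _); case: (f x) => a b; case: (f y).
Qed.

Lemma within_continuous_cabs_sqr (f : 'rV[R]_d -> R[i]) :
  ccontinuous_on Omega f -> {within Omega, continuous (fun x => cabs (f x) ^+ 2)}.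
Proof.
move=> cf; have cR := within_continuous_Re cf; have cI := within_continuous_Im cf.
rewrite (_ : (fun x => _) = (fun x => complex.Re (f x) * complex.Re (f x)) +
   (fun x => complex.Im (f x) * complex.Im (f x))); last first.
  by apply/funext => x; rewrite cabs_sqr !expr2.
move=> x; apply: continuousD; first exact: (continuousM (cR x) (cR x)).
exact: (continuousM (cI x) (cI x)).
Qed.

(** By compactness, finitely many open sets on which every [Phi j] stays within [e] of its value at
    a centre cover [Omega]. Made disjoint, each piece sends its mass to the centre, a point of
    [Omega] that may lie outside the piece. Points and weights do not depend on [F]. *)
Lemma exists_discretization (N : nat) (Phi : 'I_N -> 'rV[R]_d -> R[i]) (e : R) :
  (forall j, ccontinuous_on Omega (Phi j)) -> 0 < e ->
  exists (n : nat) (x : 'I_n -> 'rV[R]_d) (w : 'I_n -> R),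
    [/\ forall i, Omega (x i), forall i, 0 <= w i, \sum_i w i = 1 &
      forall (F : 'rV[R]_d -> R) (eta : R), {within Omega, continuous F} ->
        (forall y z, Omega y -> Omega z ->
          (forall j, cabs (Phi j y - Phi j z) < e) -> `|F y - F z| <= eta) ->
        `|Rintegral mu Omega F - \sum_i w i * F (x i)| <= eta].
Proof.
move=> cPhi e0.
pose U x := (fun y => Omega y -> forall j, cabs (Phi j x - Phi j y) < e)°.
have [D DO cover] : finite_subset_cover Omega U Omega.
  have := cOmega; rewrite compact_cover; apply=> [x _|x Ox]; first exact: open_interior.
  exists x => //; apply: nbhs_singleton; apply: nbhs_interior.
  have near_j j := ccontinuous_near (cPhi j) Ox e0.
  have := @filter_forall _ _ (fun j y => Omega y -> cabs (Phi j x - Phi j y) < e)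
    (nbhs x) (nbhs_filter x) near_j.
  move=> near_all; apply: (@filterS _ (nbhs x) _ _ _ _ near_all) => y h Oy j.
  exact: h.
pose s : seq 'rV[R]_d := finmap.enum_fset D; pose n := size s.
(* The finite cover is padded with empty sets because [seqDU] makes an infinite sequence
   disjoint. *)
pose F0 (i : nat) : set (borelRd R d) :=
  if (i < n)%N then Omega `&` U (nth 0 s i) else set0.
pose A := seqDU F0.
have mF0 i : measurable (F0 i).
  rewrite /F0; case: ifP => // _; apply: measurableI; first exact: borel_compact.
  by apply: borel_open; exact: open_interior.
have mA i : measurable (A i) by exact: seqDU_measurable.
have AO i : A i `<=` Omega.
  by move=> y [] + _; rewrite /F0; case: ifP => // _ [].
have OE : Omega = \big[setU/set0]_(i < n) A i.
  rewrite -bigsetU_seqDU; apply/seteqP; split=> y.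
    move=> Oy; have [z /= zD Uz] := cover y Oy.
    have zs : z \in s by [].
    rewrite -bigcup_mkord; exists (index z s) => /=; first by rewrite /n index_mem.
    by rewrite /F0 index_mem zs nth_index.
  rewrite -bigcup_mkord => -[i /= _]; rewrite /F0; case: ifP => // _ [].
  by [].
have intE (F : 'rV[R]_d -> R) : {within Omega, continuous F} ->
    Rintegral mu Omega F = \sum_(i < n) Rintegral mu (A i) F.
  move=> cF; have iF := within_continuous_integrable cF.
  rewrite /Rintegral {1}OE -(big_mkord xpredT A).
  rewrite integral_bigsetU_EFin //=.
  - rewrite big_mkord -sum_fine //= => i _; apply: integrable_fin_num => //.
    exact: (integrableS borel_compact).
  - exact: iota_uniq.
  - exact: sub_trivIset (@trivIset_seqDU _ F0).
  - rewrite big_mkord -OE; apply/measurable_realfun.measurable_EFinP.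
    exact: within_continuous_measurable.
pose w (i : 'I_n) := fine (mu (A i)).
have w0 i : 0 <= w i by rewrite fine_ge0.
have mu_fin i : mu (A i) \is a fin_num by exact: fin_num_measure.
have w1 : \sum_i w i = 1.
  have := intE (fun=> 1); rewrite Rintegral_cst; last exact: borel_compact.
  rewrite mul1r [X in fine X]mu1 => intw; rewrite -[RHS]/(fine 1%E) intw.
    by apply: eq_bigr => i _; rewrite Rintegral_cst // mul1r.
  by move=> ?; exact: cst_continuous.
have sO i : (i < n)%N -> Omega (nth 0 s i).
  by move=> ni; apply: set_mem; apply: DO; exact: (mem_nth 0 ni).
exists n, (fun i => nth 0 s i), w; split=> // [i|F eta cF hF]; first exact: sO.
have iF := within_continuous_integrable cF.
rewrite intE // -sumrB; apply: (le_trans (ler_norm_sum _ _ _)).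
rewrite -[leRHS]mul1r -w1 mulr_suml; apply: ler_sum => i _.
have iFi : mu.-integrable (A i) (EFin \o F) by exact: (integrableS borel_compact).
have iC (c : R) : mu.-integrable (A i) (EFin \o (fun=> c)).
  exact: finite_measure_integrable_cst.
have -> : w i * F (nth 0 s i) = Rintegral mu (A i) (fun=> F (nth 0 s i)).
  by rewrite Rintegral_cst // mulrC.
rewrite -RintegralB //.
have iB : mu.-integrable (A i) (EFin \o (fun x => F x - F (nth 0 s i))).
  rewrite (_ : _ \o _ = ((EFin \o F) \- (EFin \o (fun=> F (nth 0%R s i))))%E) //.
  exact: integrableB.
apply: (le_trans (le_normr_Rintegral _ _)) => //.
have -> : w i * eta = Rintegral mu (A i) (fun=> eta) by rewrite Rintegral_cst // mulrC.
apply: le_Rintegral => //; first exact: integrable_norm.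
move=> y Ay; have Oy := AO _ _ Ay; rewrite distrC; apply: hF => //; first exact: sO.
move: Ay => [+ _]; rewrite /F0 ltn_ord => -[_ Uy].
exact: (interior_subset Uy).
Qed.

End IntegrationOnCompact.

Section ComplexIntegral.
Variables (R : realType) (d : nat) (Omega : set 'rV[R]_d).
Variable mu : probability (borelRd R d) R.
Hypotheses (cOmega : compact Omega) (mu1 : mu Omega = 1%E).

Let integrableRe (f : 'rV[R]_d -> R[i]) : ccontinuous_on Omega f ->
  mu.-integrable Omega (EFin \o (fun x => complex.Re (f x))).
Proof. by move=> cf; apply: within_continuous_integrable => //; exact: within_continuous_Re. Qed.

Let integrableIm (f : 'rV[R]_d -> R[i]) : ccontinuous_on Omega f ->
  mu.-integrable Omega (EFin \o (fun x => complex.Im (f x))).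
Proof. by move=> cf; apply: within_continuous_integrable => //; exact: within_continuous_Im. Qed.

Let mOmega := borel_compact cOmega.

Lemma integrableZ_EFin (c : R) (F : 'rV[R]_d -> R) :
  mu.-integrable Omega (EFin \o F) -> mu.-integrable Omega (EFin \o (fun x => c * F x)).
Proof.
move=> iF; rewrite (_ : _ \o _ = (fun x => c%:E * (EFin \o F) x)%E) //.
exact: integrableZl.
Qed.

Lemma cintegralD (f g : 'rV[R]_d -> R[i]) :
  ccontinuous_on Omega f -> ccontinuous_on Omega g ->
  cintegral mu Omega (fun x => f x + g x) = cintegral mu Omega f + cintegral mu Omega g.
Proof.
move=> cf cg; rewrite /cintegral.
rewrite (_ : (fun x => complex.Re (f x + g x)) = fun x => complex.Re (f x) + complex.Re (g x));
  last by apply/funext => x /=; rewrite complexReImE.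
rewrite (_ : (fun x => complex.Im (f x + g x)) = fun x => complex.Im (f x) + complex.Im (g x));
  last by apply/funext => x /=; rewrite complexReImE.
by rewrite !RintegralD //; try exact: integrableRe; try exact: integrableIm.
Qed.

Lemma cintegralZ (c : R[i]) (f : 'rV[R]_d -> R[i]) : ccontinuous_on Omega f ->
  cintegral mu Omega (fun x => c * f x) = c * cintegral mu Omega f.
Proof.
move=> cf; rewrite /cintegral.
rewrite (_ : (fun x => complex.Re (c * f x)) =
    fun x => complex.Re c * complex.Re (f x) - complex.Im c * complex.Im (f x));
  last by apply/funext => x /=; rewrite complexReImE.
rewrite (_ : (fun x => complex.Im (c * f x)) =
    fun x => complex.Re c * complex.Im (f x) + complex.Im c * complex.Re (f x));
  last by apply/funext => x /=; rewrite complexReImE.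
have iR := integrableRe cf; have iI := integrableIm cf.
rewrite RintegralB //; try exact: integrableZ_EFin.
rewrite RintegralD //; try exact: integrableZ_EFin.
rewrite !RintegralZl //.
by case: c => a b.
Qed.

Lemma ccontinuousZ (c : R[i]) (f : 'rV[R]_d -> R[i]) :
  ccontinuous_on Omega f -> ccontinuous_on Omega (fun x => c * f x).
Proof.
move=> cf x Ox e e0.
have c0 : 0 < cabs c + 1 by apply: ltr_wpDl => //; exact: cabs_ge0.
have [del del0 h] := cf x Ox (e / (cabs c + 1)) (divr_gt0 e0 c0).
exists del => // y Oy xy; rewrite -mulrBr cabsM.
apply: (@le_lt_trans _ _ ((cabs c + 1) * cabs (f x - f y))).
  by rewrite ler_wpM2r ?cabs_ge0 // lerDl.
by have := h y Oy xy; rewrite ltr_pdivlMr // mulrC.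
Qed.

Lemma ccontinuousD (f g : 'rV[R]_d -> R[i]) : ccontinuous_on Omega f ->
  ccontinuous_on Omega g -> ccontinuous_on Omega (fun x => f x + g x).
Proof.
move=> cf cg x Ox e e0; have e2 : 0 < e / 2 by rewrite divr_gt0.
have [d1 d10 h1] := cf x Ox _ e2; have [d2 d20 h2] := cg x Ox _ e2.
exists (Num.min d1 d2); first by rewrite lt_min d10.
move=> y Oy; rewrite lt_min => /andP[x1 x2].
rewrite opprD addrACA; apply: (le_lt_trans (cabsD _ _)).
by rewrite [e]splitr ltrD ?h1 ?h2.
Qed.

Lemma ccontinuous_sum (I : finType) (A : pred I) (F : I -> 'rV[R]_d -> R[i]) :
  (forall i, ccontinuous_on Omega (F i)) ->
  ccontinuous_on Omega (fun x => \sum_(i | A i) F i x).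
Proof.
move=> cF; elim: (index_enum I) => [|i s IH].
  move=> x _ e e0; exists 1 => // y _ _.
  by rewrite !big_nil subrr cabs0.
case Ai : (A i); last by under eq_fun do rewrite big_cons Ai.
by under eq_fun do rewrite big_cons Ai; exact: ccontinuousD.
Qed.

Lemma cabs_real (r : R) : cabs r%:C%C = `|r|.
Proof. by rewrite /cabs /= expr0n /= addr0 sqrtr_sqr. Qed.

(** The unit number conj(z) / |z|, or 1 if z = 0; it reduces bounds on a modulus to bounds on a real
    part. *)
Lemma exists_rotation (z : R[i]) :
  exists2 c : R[i], cabs c = 1 & complex.Re (c * z) = cabs z.
Proof.
have [z0|z0] := eqVneq (cabs z) 0.
  exists 1; first exact: ComplexField.Normc.normc1.
  by rewrite mul1r (ComplexField.Normc.eq0_normc z0) cabs0.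
have zp : 0 < cabs z by rewrite lt_def z0 cabs_ge0.
have z2 := cabs_sqr z.
case: z z0 zp z2 => a b; set r := cabs _ => z0 zp /= r2.
exists ((a / r) +i* (- b / r))%C.
  apply/eqP; rewrite -(@eqrXn2 _ 2) ?cabs_ge0 // cabs_sqr /= !exprMn sqrrN.
  by rewrite -mulrDl exprVn -r2 mulfV ?expr1n // expf_neq0.
by rewrite /= -[RHS](mulfK z0) -expr2 r2; field.
Qed.

Lemma cabs_cintegral_le_sup (f : 'rV[R]_d -> R[i]) (S : R) :
  ccontinuous_on Omega f -> (forall x, Omega x -> cabs (f x) <= S) ->
  cabs (cintegral mu Omega f) <= S.
Proof.
move=> cf fS; have [c c1 <-] := exists_rotation (cintegral mu Omega f).
have ccf := ccontinuousZ c cf; rewrite -cintegralZ //=.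
have <- : Rintegral mu Omega (fun=> S) = S.
  by rewrite Rintegral_cst // [X in fine X]mu1 mulr1.
apply: le_Rintegral => //; first exact: integrableRe.
  exact: finite_measure_integrable_cst.
move=> x Ox; apply: le_trans (fS x Ox).
apply: le_trans (ler_norm _) _; apply: le_trans (ler_normRe _) _.
by rewrite cabsM c1 mul1r.
Qed.

End ComplexIntegral.

(** * Quadrature *)

(* Bakhvalov's linearization: the worst case error of the best quadrature with
   given nodes is attained on functions vanishing at the nodes. *)
Lemma kappa_le_vanishing (R : realType) (d : nat) (Omega : set 'rV[R]_d)
    (mu : probability (borelRd R d) R) (V : set ('rV[R]_d -> R[i]))
    (nrm : ('rV[R]_d -> R[i]) -> R) (m : nat) (xi : 'I_m -> 'rV[R]_d) (S : R) :
  compact Omega -> mu Omega = 1%E -> banach_subspace_of_C Omega V nrm ->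
  (forall nu, Omega (xi nu)) -> 0 <= S ->
  (forall f, V f -> nrm f <= 1 -> (forall nu, f (xi nu) = 0) ->
    cabs (cintegral mu Omega f) <= S) ->
  (kappa mu Omega m (unit_ball V nrm) <= S%:E)%E.
Proof.
move=> cO mu1 [Vc [V0 [VL [nrm_eq [nrm0 [nrm0_eq [nrmZ [nrmD _]]]]]]]] xiO S0 hS.
have VZ (c : R[i]) f : V f -> V (fun x => c * f x).
  move=> Vf; rewrite (_ : (fun x => _) = fun x => c * f x + 0); first exact: VL.
  by apply/funext => x; rewrite addr0.
have VD f g : V f -> V g -> V (fun x => f x + g x).
  move=> Vf Vg; rewrite (_ : (fun x => _) = fun x => 1 * f x + g x); first exact: VL.
  by apply/funext => x; rewrite mul1r.
pose add (f g : 'rV[R]_d -> R[i]) : 'rV[R]_d -> R[i] := fun x => f x + g x.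
pose scale (c : R) (f : 'rV[R]_d -> R[i]) : 'rV[R]_d -> R[i] := fun x => (c%:C)%C * f x.
(* The [m] complex evaluations become 2m real functionals, real parts before imaginary parts, so
   that the real extension argument applies. *)
pose e (i : 'I_(m + m)) (f : 'rV[R]_d -> R[i]) : R :=
  match fintype.split i with inl nu => complex.Re (f (xi nu)) | inr nu => complex.Im (f (xi nu)) end.
pose l (f : 'rV[R]_d -> R[i]) : R := complex.Re (cintegral mu Omega f).
have eR nu f : e (lshift m nu) f = complex.Re (f (xi nu)).
  by rewrite /e (unsplitK (inl nu)).
have eI nu f : e (rshift m nu) f = complex.Im (f (xi nu)).
  by rewrite /e (unsplitK (inr nu)).
have el i : linear_on add scale V (e i).
  split=> [f g _ _|c f _]; rewrite /e; case: (fintype.split i) => nu;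
    rewrite /add /scale complexReImE //=; ring.
have ll : linear_on add scale V l.
  split=> [f g Vf Vg|c f Vf]; rewrite /l.
    by rewrite /add cintegralD ?complexReImE //; exact: Vc.
  by rewrite /scale cintegralZ ?complexReImE /= ?mul0r ?subr0 //; exact: Vc.
have lp f : V f -> (forall i, e i f = 0) -> l f <= S * nrm f.
  move=> Vf ef; have fxi nu : f (xi nu) = 0.
    have := ef (lshift m nu); have := ef (rshift m nu); rewrite eR eI.
    by case: (f (xi nu)) => a b /= -> ->.
  (* A function of norm 0 cannot be normalized, but it vanishes on [Omega] and so does its
     integral. *)
  have [n0|n0] := eqVneq (nrm f) 0.
    rewrite n0 mulr0 /l /=.
    rewrite (@eq_Rintegral _ _ _ _ _ (fun=> 0)); last first.
      by move=> x /set_mem Ox; rewrite (nrm0_eq _ Vf n0 _ Ox).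
    by rewrite Rintegral_cst ?mul0r //; exact: borel_compact.
  have np : 0 < nrm f by rewrite lt_def n0 nrm0.
  pose g := scale (nrm f)^-1 f; have Vg : V g by exact: VZ.
  have ng : nrm g <= 1.
    by rewrite nrmZ // cabs_real gtr0_norm ?invr_gt0 // mulVf.
  have := hS _ Vg ng; rewrite /g /scale => /(_ _) h.
  have {}h : cabs ((((nrm f)^-1)%:C)%C * cintegral mu Omega f) <= S.
    rewrite -cintegralZ //; last exact: Vc.
    by apply: h => nu; rewrite fxi mulr0.
  rewrite cabsM cabs_real gtr0_norm ?invr_gt0 // ler_pdivrMl // mulrC in h.
  apply: le_trans h; apply: le_trans (ler_norm _) _; exact: ler_normRe.
have pD f g : V f -> V g -> S * nrm (add f g) <= S * nrm f + S * nrm g.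
  by move=> Vf Vg; rewrite -mulrDr; apply: ler_wpM2l => //; exact: nrmD.
have pZ (c : R) f : V f -> 0 <= c -> S * nrm (scale c f) = c * (S * nrm f).
  by move=> Vf c0; rewrite nrmZ // cabs_real ger0_norm // mulrCA.
have [lam hlam] := dominated_extension VD (fun c f => VZ (c%:C)%C f) pD pZ el ll lp.
(* The conjugate sign is chosen since Re ((a - ib) z) = a Re z + b Im z. *)
pose lamC (nu : 'I_m) : R[i] := (lam (lshift m nu) -i* lam (rshift m nu))%C.
apply: le_trans (_ : (ereal_sup [set (cabs (cintegral mu Omega f -
    \sum_(nu < m) lamC nu * f (xi nu)))%:E | f in unit_ball V nrm] <= _)%E).
  by apply: ereal_inf_lbound; exists xi, lamC.
apply: ge_ereal_sup => _ [f [Vf nf] <-]; rewrite lee_fin.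
(* The unit ball is invariant under unit scalars, so the real bound for the rotated [f] bounds the
   complex error. *)
have [c c1 <-] := exists_rotation (cintegral mu Omega f - \sum_(nu < m) lamC nu * f (xi nu)).
have Vcf := VZ c f Vf.
apply: (@le_trans _ _ (S * nrm (fun x => c * f x))); last first.
  by rewrite nrmZ // c1 mul1r ler_piMr.
apply: le_trans (hlam _ Vcf); rewrite le_eqVlt; apply/orP; left; apply/eqP.
rewrite mulrBr mulr_sumr -cintegralZ //; last exact: Vc.
rewrite [LHS](_ : _ = l (fun x => c * f x) -
   complex.Re (\sum_(nu < m) c * (lamC nu * f (xi nu)))); last first.
  by rewrite /l; case: (cintegral _ _ _) => a b; case: (\sum_(nu < m) _).
congr (_ - _); set h := fun x => c * f x.
rewrite Re_sum [RHS](_ : _ = \sum_(nu < m) (lam (lshift m nu) * e (lshift m nu) h +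
    lam (rshift m nu) * e (rshift m nu) h)); last by rewrite big_split_ord big_split.
apply: eq_bigr => nu _.
rewrite eR eI /h mulrCA; case: (c * f (xi nu)) => a b /=; ring.
Qed.

Lemma sqr_average_le (R : realType) (P : finType) (w c : P -> R) :
  (forall x, 0 <= w x) -> \sum_x w x = 1 ->
  (\sum_x w x * c x) ^+ 2 <= \sum_x w x * c x ^+ 2.
Proof.
move=> w0 w1; set a := \sum_x w x * c x.
have : 0 <= \sum_x w x * (c x - a) ^+ 2.
  by apply: sumr_ge0 => x _; rewrite mulr_ge0 ?sqr_ge0.
rewrite (eq_bigr (fun x => w x * c x ^+ 2 + (- (2 * a) * (w x * c x) + a ^+ 2 * w x)));
  last by move=> x _; ring.
rewrite !big_split /= -!mulr_sumr w1 -/a; set X := \sum_x _.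
move=> h; rewrite -subr_ge0; apply: le_trans h _; rewrite le_eqVlt; apply/orP; left.
by apply/eqP; ring.
Qed.

(** The factor [2 * K], instead of [K], leaves room for the error of replacing [mu] by a finite
    weighted set. *)
Lemma exists_finite_sampling (R : realType) (K : R) : 1 <= K ->
  exists2 C : R, 0 < C & forall v N m : nat,
    (1 <= v)%N -> (v <= N)%N -> (1 <= m)%N ->
    C * v%:R * ln N%:R * (ln (2 * v%:R)) ^+ 2 * (ln (2 * v%:R) + ln (ln N%:R))
      <= m%:R ->
    forall (P : finType) (w : P -> R) (phi : 'I_N -> P -> R[i]),
    (forall x, 0 <= w x) -> \sum_x w x = 1 -> (forall j x, cabs (phi j x) <= 1) ->
    exists xi : m.-tuple P, forall (J : {set 'I_N}) (a : 'I_N -> R[i]) (b : R),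
      let g x := \sum_(j in J) a j * phi j x in
      #|J| = v ->
      \sum_(j in J) cabs (a j) ^+ 2 <= 2 * K * \sum_x w x * cabs (g x) ^+ 2 ->
      (forall x, x \in xi -> cabs (g x) <= b) ->
      \sum_x w x * cabs (g x) ^+ 2 <= 15 * b ^+ 2.
Proof.
move=> K1; have [C C0 hC] := sampling_budget K1.
exists C => // v N m v1 vN m1 hm P w phi w0 w1 phi1.
have [N2|N1] := leqP 2 N.
  have [T hT] := hC v N m v1 N2 m1 hm.
  by apply: exists_sparse_sampling hT => //; exact: leq_trans vN.
(* For N = 1 the factor ln N = 0 makes the condition on [m] void. As [g] is a multiple of the only
   dictionary function, one node where its square modulus is at least average suffices. *)
have {N1} N1 : N = 1%N by apply/eqP; rewrite eqn_leq -ltnS N1 (leq_trans v1).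
subst N; have [x0 hx0] := exists_le_average (fun x => - cabs (phi ord0 x) ^+ 2) w0 w1.
exists [tuple of nseq m x0] => J a b g cJ _ gb.
have gE x : g x = (if ord0 \in J then a ord0 else 0) * phi ord0 x.
  by rewrite /g big_mkcond big_ord1; case: ifP => _; rewrite ?mul0r.
set a0 := if _ then _ else _ in gE.
have gx0 : cabs (g x0) <= b by apply: gb; rewrite mem_nseq m1 eqxx.
have h1 : \sum_x w x * cabs (g x) ^+ 2 <= cabs (g x0) ^+ 2.
  under eq_bigr do rewrite gE cabsM exprMn mulrCA.
  rewrite -mulr_sumr gE cabsM exprMn ler_wpM2l ?sqr_ge0 //.
  by move: hx0; under eq_bigr do rewrite mulrN; rewrite sumrN lerN2.
apply: (le_trans h1).
have h2 : cabs (g x0) ^+ 2 <= b ^+ 2.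
  by rewrite ler_pXn2r ?nnegrE ?cabs_ge0 // (le_trans (cabs_ge0 _) gx0).
by apply: (le_trans h2); have := sqr_ge0 b; clear; lra.
Qed.

Lemma sqr_l1_le (R : realType) (N : nat) (J : {set 'I_N}) (a : 'I_N -> R[i]) :
  (\sum_(j in J) cabs (a j)) ^+ 2 <= N%:R * \sum_(j in J) cabs (a j) ^+ 2.
Proof.
apply: (le_trans (sqr_sum_le _ _)); apply: ler_wpM2r.
  by apply: sumr_ge0 => j _; exact: sqr_ge0.
by rewrite ler_nat; have := max_card (mem J); rewrite card_ord.
Qed.

(** The nodes are found on a discretization of [mu] so fine that passing between [mu] and the finite
    set costs only a small fraction of the mean square [D]. The fineness depends on [N] and [K]
    alone, hence serves all sparse [g] at once. *)
Lemma exists_sampling_points (R : realType) (K : R) : 0 < K ->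
  exists2 C : R, 0 < C &
  forall (d : nat) (Omega : set 'rV[R]_d) (mu : probability (borelRd R d) R)
    (v N : nat) (Phi : 'I_N -> 'rV[R]_d -> R[i]) (m : nat),
    compact Omega -> mu Omega = 1%E -> (1 <= v)%N -> (v <= N)%N ->
    (forall j, ccontinuous_on Omega (Phi j)) ->
    (forall j x, Omega x -> cabs (Phi j x) <= 1) ->
    (forall a : 'I_N -> R[i],
       (((\sum_(j < N) cabs (a j) ^+ 2)%R)%:E
        <= K%:E * L2norm2 mu Omega (fun x => (\sum_(j < N) a j * Phi j x)%R))%E) ->
    (1 <= m)%N ->
    C * v%:R * ln N%:R * (ln (2 * v%:R)) ^+ 2 * (ln (2 * v%:R) + ln (ln N%:R))
      <= m%:R ->
    exists2 xi : 'I_m -> 'rV[R]_d, (forall nu, Omega (xi nu)) &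
      forall g b, Sigma_v v Phi g -> (forall nu, cabs (g (xi nu)) <= b) ->
        cabs (cintegral mu Omega g) <= 4 * b.
Proof.
move=> K0; pose K1 := K + 1; have K11 : 1 <= K1 by rewrite /K1 lerDr ltW.
have K10 : 0 < K1 by exact: lt_le_trans K11.
have KK1 : K <= K1 by rewrite /K1 lerDl.
clearbody K1.
have [C C0 hC] := exists_finite_sampling K11.
exists C => // d Omega mu v N Phi m cO mu1 v1 vN cPhi Phi1 hK m1 hm.
have NR : 1 <= N%:R :> R by rewrite ler1n (leq_trans v1).
have N0 : 0 < N%:R :> R by exact: lt_le_trans NR.
have M0 : 0 < 400 * N%:R * K1 by apply: mulr_gt0; [apply: mulr_gt0; [rewrite ltr0n|]|].
(* With A^2 <= N S2, the discretization error 2 e A^2 of the mean square satisfies K1 * 2 e A^2 <=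
   S2 / 200. *)
pose e : R := (400 * N%:R * K1)^-1.
have e0 : 0 < e by rewrite invr_gt0.
have e400 : e <= 400^-1.
  rewrite lef_pV2 ?posrE ?ltr0n // -mulrA ler_peMr ?ler0n //; exact: mulr_ege1.
have eE : e * (400 * N%:R * K1) = 1 by exact: mulVf (lt0r_neq0 M0).
clearbody e.
have [n [y [w [yO w0 w1 hw]]]] := exists_discretization cO mu1 cPhi e0.
have [xi hxi] := hC v N m v1 vN m1 hm _ w (fun j i => Phi j (y i)) w0 w1
  (fun j i => Phi1 j _ (yO i)).
exists (fun nu => y (tnth xi nu)) => // g b [J [a [cJ gE]]] gb.
have {gb} gb i : i \in xi -> cabs (g (y i)) <= b by case/tnthP => nu ->.
have b0 : 0 <= b by apply: le_trans (gb _ (mem_tnth (Ordinal m1) xi)); exact: cabs_ge0.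
pose S2 := \sum_(j in J) cabs (a j) ^+ 2; pose A := \sum_(j in J) cabs (a j).
pose D := \sum_i w i * cabs (g (y i)) ^+ 2.
have A0 : 0 <= A by apply: sumr_ge0 => j _; exact: cabs_ge0.
have S20 : 0 <= S2 by apply: sumr_ge0 => j _; exact: sqr_ge0.
have D0 : 0 <= D by apply: sumr_ge0 => i _; apply: mulr_ge0 => //; exact: sqr_ge0.
have A2 : A ^+ 2 <= N%:R * S2 by exact: sqr_l1_le.
have hD : S2 <= 2 * K1 * D -> D <= 15 * b ^+ 2.
  by move=> h; have := hxi J a b cJ; rewrite -/S2 /D gE in h gb *; apply.
have cg : ccontinuous_on Omega g.
  by rewrite gE; apply: ccontinuous_sum => j; apply: ccontinuousZ; exact: cPhi.
have gA x : Omega x -> cabs (g x) <= A.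
  move=> Ox; rewrite gE; apply: (le_trans (cabs_sum _ _)); apply: ler_sum => j _.
  by rewrite cabsM ler_piMr ?cabs_ge0 ?Phi1.
have osc x z : (forall j, cabs (Phi j x - Phi j z) < e) -> cabs (g x - g z) <= e * A.
  move=> h; rewrite gE -sumrB; apply: (le_trans (cabs_sum _ _)).
  rewrite mulr_sumr; apply: ler_sum => j _.
  by rewrite -mulrBr cabsM mulrC ler_wpM2r ?cabs_ge0 // ltW.
clearbody A.
pose Q := Rintegral mu Omega (fun x => cabs (g x) ^+ 2).
have cQ := within_continuous_cabs_sqr cg.
have L2Q : L2norm2 mu Omega g = Q%:E.
  have iQ := within_continuous_integrable mu cO cQ.
  have fQ := integrable_fin_num (borel_compact cO) iQ.
  by rewrite /Q /Rintegral fineK.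
have Q0 : 0 <= Q by apply: Rintegral_ge0 => x _; exact: sqr_ge0.
have S2Q : S2 <= K * Q.
  have := hK (fun j => if j \in J then a j else 0).
  rewrite (_ : (fun x => \sum_(j < N) _) = g); last first.
    apply/funext => x; rewrite gE [RHS]big_mkcond; apply: eq_bigr => j _.
    by case: ifP; rewrite ?mul0r.
  rewrite L2Q -EFinM lee_fin; apply: le_trans.
  rewrite /S2 [leLHS]big_mkcond; apply: ler_sum => j _.
  by case: ifP => // _; exact: sqr_ge0.
have QD : Q <= D + 2 * e * A ^+ 2.
  have := hw _ (2 * e * A ^+ 2) cQ; rewrite -/Q -/D => /(_ _) h.
  suff : `|Q - D| <= 2 * e * A ^+ 2.
    by move=> /(le_trans (ler_norm _)); rewrite lerBlDl.
  apply: h => x z Ox Oz /osc xz.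
  have d1 : `|cabs (g x) - cabs (g z)| <= e * A.
    apply: le_trans xz; rewrite ler_norml; apply/andP; split.
      have := cabsD (g z - g x) (g x); rewrite subrK -[g z - g x]opprB cabsN; clear; lra.
    by have := cabsD (g x - g z) (g z); rewrite subrK; clear; lra.
  rewrite subr_sqr normrM (_ : 2 * e * A ^+ 2 = (e * A) * (2 * A)); last by ring.
  apply: ler_pM => //; rewrite ger0_norm ?addr_ge0 ?cabs_ge0 //.
  have := gA _ Ox; have := gA _ Oz; clear; lra.
have eK : K1 * (2 * e * (N%:R * S2)) = S2 / 200.
  have : K1 * (2 * e * (N%:R * S2)) * 200 = e * (400 * N%:R * K1) * S2 by ring.
  by rewrite eE mul1r; clear; lra.
(* S2 <= K1 D + S2 / 200, so the error is absorbed on the left and the constant at most doubles. *)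
have SD : S2 <= 2 * K1 * D.
  have h1 : K * Q <= K1 * Q by rewrite ler_wpM2r.
  have h2 : K1 * Q <= K1 * (D + 2 * e * (N%:R * S2)).
    apply: ler_wpM2l; first exact: ltW.
    apply: (le_trans QD); rewrite lerD2l; apply: ler_wpM2l A2.
    by apply: mulr_ge0; [exact: ler0n|exact: ltW].
  move: h2; rewrite mulrDr eK; have : 0 <= K1 * D by rewrite mulr_ge0 // ltW.
  move: S2Q h1 S20; clear; lra.
have {hD} hD := hD SD.
pose t := e * A.
have t0 : 0 <= t by rewrite mulr_ge0 // ltW.
have t2 : t ^+ 2 <= D / 10000.
  have h1 : t ^+ 2 <= e * (e * (N%:R * S2)).
    by rewrite /t exprMn expr2 -mulrA !(ler_wpM2l (ltW e0)).
  have h2 : e * (e * (N%:R * S2)) <= 400^-1 * (e * (N%:R * S2)).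
    apply: ler_wpM2r e400; apply: mulr_ge0; first exact: ltW.
    by apply: mulr_ge0; first exact: ltW.
  have h3 : e * (N%:R * S2) <= e * (N%:R * (2 * K1 * D)).
    by rewrite !ler_wpM2l // ltW.
  have h4 : e * (N%:R * (2 * K1 * D)) = D / 200.
    have : e * (N%:R * (2 * K1 * D)) * 200 = e * (400 * N%:R * K1) * D by ring.
    by rewrite eE mul1r; clear; lra.
  move: h1 h2 h3 D0; rewrite h4; clear; lra.
pose r := \sum_i w i * cabs (g (y i)).
have r0 : 0 <= r by apply: sumr_ge0 => i _; apply: mulr_ge0 => //; exact: cabs_ge0.
have r2 : r ^+ 2 <= D by exact: sqr_average_le.
have Ig : cabs (cintegral mu Omega g) <= r + t.
  have [c c1 <-] := exists_rotation (cintegral mu Omega g).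
  rewrite -cintegralZ //=; have ccg := ccontinuousZ c cg.
  have := hw _ t (within_continuous_Re ccg) => /(_ _) h.
  have {}h := h _; apply: (@le_trans _ _ (\sum_i w i * complex.Re (c * g (y i)) + t)).
    rewrite -lerBlDl; apply: le_trans (ler_norm _) _; apply: h => x z _ _ /osc xz.
    apply: le_trans xz; rewrite -[leRHS]mul1r -c1 -cabsM mulrBr.
    apply: le_trans (ler_normRe _).
    by case: (c * g x) => ? ?; case: (c * g z).
  rewrite lerD2r; apply: ler_sum => i _; apply: ler_wpM2l => //.
  by apply: le_trans (ler_norm _) _; apply: le_trans (ler_normRe _) _; rewrite cabsM c1 mul1r.
apply: (le_trans Ig); rewrite -(@ler_pXn2r _ 2) ?nnegrE ?addr_ge0 //; last first.
  by apply: mulr_ge0; first exact: ler0n.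
(* This gives 2rt <= r^2 / 100 + 100 t^2, so (r + t)^2 <= 1.0201 D <= 16 b^2. *)
have : 0 <= (r / 10 - 10 * t) ^+ 2 by exact: sqr_ge0.
have b2 := sqr_ge0 b; rewrite !expr2 in r2 t2 hD b2 *.
move: r2 t2 hD b2; clear; nra.
Qed.

Theorem theorem4p5 (R : realType) (K : R) (hK : 0 < K) :
  exists2 C : R, 0 < C &
  forall (d : nat) (Omega : set 'rV[R]_d)
         (mu : probability (borelRd R d) R)
         (v N : nat) (Phi : 'I_N -> 'rV[R]_d -> R[i])
         (V : set ('rV[R]_d -> R[i])) (nrm : ('rV[R]_d -> R[i]) -> R)
         (m : nat),
    compact Omega ->
    mu Omega = 1%E ->
    (1 <= v)%N -> (v <= N)%N ->
    (forall j, ccontinuous_on Omega (Phi j)) ->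
    (forall j x, Omega x -> cabs (Phi j x) <= 1) ->
    (forall a : 'I_N -> R[i],
       (((\sum_(j < N) cabs (a j) ^+ 2)%R)%:E
        <= K%:E * L2norm2 mu Omega (fun x => (\sum_(j < N) a j * Phi j x)%R))%E) ->
    banach_subspace_of_C Omega V nrm ->
    (1 <= m)%N ->
    C * v%:R * ln N%:R * (ln (2 * v%:R)) ^+ 2 * (ln (2 * v%:R) + ln (ln N%:R))
      <= m%:R ->
    (kappa mu Omega m (unit_ball V nrm)
     <= 5%:E * sigma_inf Omega v (unit_ball V nrm) Phi)%E.
Proof.
have [C C0 hC] := exists_sampling_points hK.
exists C => // d Omega mu v N Phi V nrm m cO mu1 v1 vN cPhi Phi1 hPhi banV m1 hm.
have [xi xiO hxi] := hC d Omega mu v N Phi m cO mu1 v1 vN cPhi Phi1 hPhi m1 hm.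
have [Vc [V0 [_ [nrm_eq [_ [_ [nrmZ _]]]]]]] := banV.
set sigma := sigma_inf _ _ _ _.
have W0 : unit_ball V nrm (fun=> 0).
  split=> //; have -> : nrm (fun=> 0) = nrm (fun x : 'rV[R]_d => 0 * (0 : R[i])).
    by congr nrm; apply/funext => x; rewrite mul0r.
  by rewrite (nrmZ 0 (fun=> 0)) // cabs0 mul0r.
have sigma0 : (0 <= sigma)%E.
  apply: le_trans (ereal_sup_ubound _); last by exists (fun=> 0).
  apply: le_ereal_inf_tmp => _ [g _ <-].
  apply: le_trans (ereal_sup_ubound _); last by exists (xi (Ordinal m1)).
  by rewrite lee_fin cabs_ge0.
case sE : sigma sigma0 => [s| |] // sigma0; last by rewrite gt0_muley ?lte_fin ?leey.
rewrite -EFinM; apply: (kappa_le_vanishing cO mu1 banV xiO).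
  by apply: mulr_ge0; [exact: ler0n|rewrite -lee_fin].
(* The infimum defining the best approximation may not be attained, hence the slack e / 5. The
   factor 5 is 4 for the integral of [g], small at the nodes where [f] vanishes, plus 1 for that of
   f - g. *)
move=> f Vf nf fxi; apply/ler_addgt0Pr => e e0.
have e5 : 0 < e / 5 by rewrite divr_gt0.
have [g Sg fg] : exists2 g, Sigma_v v Phi g & forall x, Omega x -> cabs (f x - g x) <= s + e / 5.
  have : (ereal_inf [set sup_dist Omega f g | g in Sigma_v v Phi] < (s + e / 5)%:E)%E.
    apply: (@le_lt_trans _ _ sigma); first by apply: ereal_sup_ubound; exists f.
    by rewrite sE lte_fin ltrDl.
  move=> /ereal_inf_lt [_ [g Sg <-] hlt]; exists g => // x Ox.
  by rewrite -lee_fin; apply: le_trans (ltW hlt); apply: ereal_sup_ubound; exists x.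
have Ig : cabs (cintegral mu Omega g) <= 4 * (s + e / 5).
  by apply: hxi => // nu; have := fg _ (xiO nu); rewrite fxi sub0r cabsN.
have cg : ccontinuous_on Omega g.
  case: Sg => J [a [_ ->]]; apply: ccontinuous_sum => j; apply: ccontinuousZ; exact: cPhi.
have cNg := ccontinuousZ (-1) cg; have cf := Vc f Vf.
have cfg := ccontinuousD cf cNg.
have Ifg : cabs (cintegral mu Omega (fun x => f x + -1 * g x)) <= s + e / 5.
  by apply: cabs_cintegral_le_sup => // x Ox; rewrite mulN1r; exact: fg.
have IE : cintegral mu Omega f =
    cintegral mu Omega (fun x => f x + -1 * g x) + cintegral mu Omega g.
  by rewrite -cintegralD //; congr cintegral; apply/funext => x; ring.
rewrite IE; apply: (le_trans (cabsD _ _)); move: Ig Ifg; clear; lra.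
Qed.
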